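(* Let $f$ be a meromorphic function on $\mathbb{C}$ admitting the full expansion $$f(z)=\sum_{k=1}^\infty\sum_{n=1}^{o_k}\frac{a_{-n}^{(k)}}{(z-z_k)^n}+g(z)$$ with respect to the regions $\Omega_1\subset\Omega_2\subset\cdots$, where $g(z)=\lim_{m\to\infty}g_m(z)$, and define the approximate expansion $$f_m(z)=\sum_{z_k\in\Omega_m}\sum_{n=1}^{o_k}\frac{a_{-n}^{(k)}}{(z-z_k)^n}+g(z).$$ Then, for $z\in\Omega_m$ not a pole of $f$, the error $e_m(z)=f_m(z)-f(z)$ can be written, up to an overall sign in the first expression, as either $$e_m(z)=-\sum_{z_k\notin\Omega_m}\sum_{n=1}^{o_k}\frac{a_{-n}^{(k)}}{(z-z_k)^n}\qquad\text{or}\qquad e_m(z)=g(z)-g_m(z);$$ that is, both equalities hold.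
   Context: The poles of $f$ are $z_1,z_2,\dots$; $z_k$ has order $o_k$ and $a_{-n}^{(k)}$ is the coefficient of $(z-z_k)^{-n}$ in the Laurent expansion of $f$ about $z_k$. The regions $\Omega_m$ are bounded open simply connected sets with $\Omega_m\subset\Omega_{m+1}$ and $\bigcup_m\Omega_m=\mathbb{C}$, each bounded by a positively oriented simple closed piecewise smooth contour $\partial\Omega_m$ not passing through any pole of $f$. For $z\in\Omega_m$, $g_m(z)=\frac{1}{2\pi i}\oint_{\partial\Omega_m}\frac{f(w)}{w-z}\,dw$. Infinite sums over poles are limits over the regions: $\sum_{k=1}^\infty=\lim_{M\to\infty}\sum_{z_k\in\Omega_M}$ and $\sum_{z_k\notin\Omega_m}=\lim_{M\to\infty}\sum_{z_k\in\Omega_M\setminus\Omega_m}$. The assumption is that these limits and the limit defining $g$ exist and the full expansion holds. *)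

(* Defs.v *)
(* Stdlib reals with Coquelicot's complex numbers.  Sets of complex numbers are
   predicates C -> Prop; curves are maps R -> C of which only the restriction
   to [0,1] matters. *)
From Stdlib Require Import Reals ZArith List ClassicalEpsilon.
From Coquelicot Require Import Coquelicot.

Set Implicit Arguments.
Open Scope C_scope.

Definition C_cvg (u : nat -> C) (l : C) : Prop :=
  filterlim u eventually (locally (T := C_UniformSpace) l).

(* Sum of F over a finite set A.  The value does not depend on the chosen
   enumeration; it is unspecified when A is infinite, which never happens below
   since a bounded set contains only finitely many poles of a meromorphic
   function. *)
Definition enumerates (l : list C) (A : C -> Prop) : Prop :=
  NoDup l /\ forall p, In p l <-> A p.

Definition sum_over (A : C -> Prop) (F : C -> C) : C :=
  fold_right Cplus 0
    (map F (epsilon (inhabits nil) (fun l => enumerates l A))).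

(** * Meromorphic functions *)

Definition holomorphic_at (f : C -> C) (p : C) : Prop :=
  locally (T := C_UniformSpace) p
    (fun z => ex_derive (K := C_AbsRing) (V := C_NormedModule) f z).

(* f(z) = sum_(n in Z) a_n (z - p)^n on some punctured disc about p *)
Definition laurent_expansion (f : C -> C) (p : C) (a : Z -> C) : Prop :=
  exists r : R, (0 < r)%R /\
  forall z : C, (0 < Cmod (z - p) < r)%R ->
  exists s t : C,
    is_series (K := C_AbsRing) (V := C_NormedModule)
      (fun n => a (Z.of_nat n) * (z - p) ^ n) s /\
    is_series (K := C_AbsRing) (V := C_NormedModule)
      (fun n => a (- Z.of_nat (S n))%Z / (z - p) ^ S n) t /\
    f z = s + t.

Definition pole_data (f : C -> C) (p : C) (o : nat) (a : Z -> C) : Prop :=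
  laurent_expansion f p a /\
  (1 <= o)%nat /\
  a (- Z.of_nat o)%Z <> 0 /\
  (forall n : nat, (o < n)%nat -> a (- Z.of_nat n)%Z = 0).

Definition is_pole (f : C -> C) (p : C) : Prop :=
  exists (o : nat) (a : Z -> C), pole_data f p o a.

(* f is a total function; its values at the poles are irrelevant. *)
Definition meromorphic (f : C -> C) : Prop :=
  forall p : C, holomorphic_at f p \/ is_pole f p.

(** * Contours *)

(* A function on [s,t] is C^1, with one-sided derivatives at the end points,
   iff it is the restriction of a C^1 function on the line. *)
Definition C1_on (c : R -> C) (s t : R) : Prop :=
  exists (e e' : R -> C),
    (forall u, is_derive (K := R_AbsRing) (V := C_R_NormedModule) e u (e' u)) /\
    (forall u, continuous (T := R_UniformSpace) (U := C_UniformSpace) e' u) /\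
    (forall u, (s <= u <= t)%R -> c u = e u).

(* The pieces are closed intervals sharing their end points, so c is
   continuous on [0,1]. *)
Definition piecewise_smooth (c : R -> C) : Prop :=
  exists (n : nat) (t : nat -> R),
    t O = 0%R /\ t n = 1%R /\
    forall i, (i < n)%nat -> (t i < t (S i))%R /\ C1_on c (t i) (t (S i)).

Definition simple_closed (c : R -> C) : Prop :=
  c 0%R = c 1%R /\
  forall s t : R, (0 <= s < 1)%R -> (0 <= t < 1)%R -> c s = c t -> s = t.

Definition trace (c : R -> C) (p : C) : Prop :=
  exists t : R, (0 <= t <= 1)%R /\ c t = p.

(* For a curve that is piecewise smooth on [0,1] this is unspecified at the end
   points and the finitely many corners, which do not affect Riemann
   integrals. *)
Definition velocity (c : R -> C) (t : R) : C :=
  (Derive (fun s => Re (c s)) t, Derive (fun s => Im (c s)) t).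

Definition contour_integral (c : R -> C) (F : C -> C) : C :=
  RInt (V := C_R_CompleteNormedModule) (fun t => F (c t) * velocity c t) 0 1.

Definition cauchy_integral (c : R -> C) (f : C -> C) (z : C) : C :=
  / (2 * PI * Ci) * contour_integral c (fun w => f w / (w - z)).

Definition winding_number (c : R -> C) (p : C) : C :=
  cauchy_integral c (fun _ => 1) p.

(** * Regions *)

Definition bounded (A : C -> Prop) : Prop :=
  exists M : R, forall p, A p -> (Cmod p <= M)%R.

Definition path_in (A : C -> Prop) (d : R -> C) : Prop :=
  (forall t, continuous (T := R_UniformSpace) (U := C_UniformSpace) d t) /\
  forall t, (0 <= t <= 1)%R -> A (d t).

Definition joined (A : C -> Prop) (p q : C) : Prop :=
  exists d : R -> C, path_in A d /\ d 0%R = p /\ d 1%R = q.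

(* Paths and homotopies on [0,1] and [0,1]^2 are given by continuous
   extensions to R and R^2, which always exist (clamp the parameters). *)
Definition simply_connected (A : C -> Prop) : Prop :=
  (forall p q, A p -> A q -> joined A p q) /\
  forall d : R -> C, path_in A d -> d 0%R = d 1%R ->
  exists (H : R * R -> C) (q : C),
    (forall x, continuous (T := prod_UniformSpace R_UniformSpace R_UniformSpace)
                 (U := C_UniformSpace) H x) /\
    (forall s t, (0 <= s <= 1)%R -> (0 <= t <= 1)%R -> A (H (s, t))) /\
    (forall t, (0 <= t <= 1)%R -> H (0%R, t) = d t) /\
    (forall t, (0 <= t <= 1)%R -> H (1%R, t) = q) /\
    (forall s, (0 <= s <= 1)%R -> H (s, 0%R) = H (s, 1%R)).

Definition boundary (A : C -> Prop) (p : C) : Prop :=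
  forall eps : R, (0 < eps)%R ->
    (exists q, (Cmod (q - p) < eps)%R /\ A q) /\
    (exists q, (Cmod (q - p) < eps)%R /\ ~ A q).

(* The points enclosed by K: those whose component in the complement of K is
   bounded.  For compact K that complement is open, so its components are its
   path components. *)
Definition inside (K : C -> Prop) (p : C) : Prop :=
  ~ K p /\ bounded (joined (fun q => ~ K q) p).

(* By the Jordan curve theorem the boundary of [inside (trace c)] is
   [trace c].  Positive orientation means that c winds once
   counterclockwise around each enclosed point. *)
Definition positively_bounded_by (A : C -> Prop) (c : R -> C) : Prop :=
  piecewise_smooth c /\ simple_closed c /\
  (forall p, boundary A p <-> trace c p) /\
  (forall p, A p <-> inside (trace c) p) /\
  (forall p, A p -> winding_number c p = 1).

Definition region (A : C -> Prop) (c : R -> C) : Prop :=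
  bounded A /\ open (T := C_UniformSpace) A /\ simply_connected A /\
  positively_bounded_by A c.

Definition exhausting_regions (f : C -> C)
    (Omega : nat -> C -> Prop) (gamma : nat -> R -> C) : Prop :=
  (forall m, region (Omega m) (gamma m)) /\
  (forall m p, Omega m p -> Omega (S m) p) /\
  (forall p, exists m, Omega m p) /\
  (forall m p, trace (gamma m) p -> ~ is_pole f p).

(** * Expansions over poles *)

(* Poles index themselves: o p is the order of the pole p and a p its Laurent
   coefficients. *)
Definition principal_part (o : C -> nat) (a : C -> Z -> C) (z p : C) : C :=
  sum_n_m (G := C_AbelianGroup)
    (fun n => a p (- Z.of_nat n)%Z / (z - p) ^ n) 1 (o p).

(* s is the sum of F over the points of A, taken as a limit over the regions. *)
Definition region_sum (Omega : nat -> C -> Prop) (A : C -> Prop)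
    (F : C -> C) (s : C) : Prop :=
  C_cvg (fun M => sum_over (fun p => A p /\ Omega M p) F) s.

Definition full_expansion (f : C -> C) (o : C -> nat) (a : C -> Z -> C)
    (Omega : nat -> C -> Prop) (gamma : nat -> R -> C) (g : C -> C) : Prop :=
  forall z : C, ~ is_pole f z ->
    C_cvg (fun m => cauchy_integral (gamma m) f z) (g z) /\
    exists s : C,
      region_sum Omega (is_pole f) (principal_part o a z) s /\
      f z = s + g z.

Definition approx_expansion (f : C -> C) (o : C -> nat) (a : C -> Z -> C)
    (Omega : nat -> C -> Prop) (g : C -> C) (m : nat) (z : C) : C :=
  sum_over (fun p => is_pole f p /\ Omega m p) (principal_part o a z) + g z.

(* Main.v *)
(* Subtracting from f its singular parts at the finitely many poles in a large box leaves a
   function h that is holomorphic on the box, so Cauchy's formula on the box and partial fractions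
   evaluate the integral of f(w)/(w-z) over the boundary of Omega_m in terms of winding numbers:
   it is h(z) plus the sum over the poles p of (1 - n(p)) times the singular part at p, evaluated
   at z.  Since n(p) is 1 for p in Omega_m and 0 outside, only the poles outside Omega_m survive.
   The winding number vanishes outside because it is constant along a path that avoids the curve
   and 0 far away; no form of the Jordan curve theorem is involved. *)
Require Import Defs.
From Stdlib Require Import Reals ZArith.
From Coquelicot Require Import Coquelicot.
From Stdlib Require Import List Lra Lia Psatz ClassicalEpsilon Permutation.
Open Scope C_scope.

(** * Complex differentiation *)

(** The two equalities differ in depth. The first only splits partial sums of the full expansion:
    for M at least m the sum over [Omega M] is the fixed sum over [Omega m] plus the rest, so the
    rest converges too. The second is an identity at fixed m between f, its Cauchy integral and a
    finite sum, and carries the complex analysis. The obstacle in Cauchy's formula is the quotient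
    (h(w) - h(z))/(w - z): it is continuous at z, but at this stage its differentiability there is
    unknown. Hence Goursat's theorem is extended to rectangles with one exceptional corner, and
    primitives on a box are integrated from that exceptional point. A box is a convenient domain
    because it contains the whole curve and, once the singular parts are subtracted, no singularity.
    Goursat's theorem and the finiteness of the set of poles in a box rest on the same bisection
    principle. *)

Notation is_cderive := (is_derive (K := C_AbsRing) (V := C_NormedModule)).
Notation ex_cderive := (ex_derive (K := C_AbsRing) (V := C_NormedModule)).
Notation locC := (locally (T := C_UniformSpace)).
Notation ccont := (continuous (T := C_UniformSpace) (U := C_UniformSpace)).
Notation rcont := (continuous (T := R_UniformSpace) (U := C_UniformSpace)).
Notation is_rderive := (is_derive (K := R_AbsRing) (V := C_R_NormedModule)).
Notation is_CInt := (is_RInt (V := C_R_NormedModule)).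

(** Balls of [C_UniformSpace] are squares, since it is a product of two copies of R; passing to
    discs in [Cmod] costs the factor [sqrt 2]. *)
Lemma locC_iff (z : C) (P : C -> Prop) :
  locC z P <-> exists d, (0 < d)%R /\ forall w, (Cmod (w - z) < d)%R -> P w.
Proof.
  split.
  - intros [d H]. exists d. split. apply cond_pos.
    intros w Hw. apply H. apply C_NormedModule_mixin_compat1. exact Hw.
  - intros [d [Hd H]].
    assert (H2 : (0 < d / sqrt 2)%R).
    { apply Rdiv_lt_0_compat; auto. apply sqrt_lt_R0; lra. }
    exists (mkposreal _ H2). intros w Hw. apply H.
    apply (C_NormedModule_mixin_compat2 z w) in Hw. simpl in Hw.
    replace (sqrt 2 * (d / sqrt 2))%R with d in Hw. exact Hw.
    field. apply Rgt_not_eq, sqrt_lt_R0; lra.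
Qed.

Lemma filterlim_C_iff {T : Type} (F : (T -> Prop) -> Prop) {FF : Filter F}
    (f : T -> C) (l : C) :
  filterlim f F (locC l) <->
  forall eps, (0 < eps)%R -> F (fun x => (Cmod (f x - l) < eps)%R).
Proof.
  split.
  - intros H eps He. apply (H (fun w => (Cmod (w - l) < eps)%R)).
    apply locC_iff. exists eps. auto.
  - intros H P HP. apply locC_iff in HP. destruct HP as [d [Hd HP]].
    unfold filtermap. generalize (H d Hd). apply filter_imp. auto.
Qed.

Lemma ccont_iff (f : C -> C) (z : C) :
  ccont f z <-> forall eps, (0 < eps)%R -> exists d, (0 < d)%R /\
    forall w, (Cmod (w - z) < d)%R -> (Cmod (f w - f z) < eps)%R.
Proof.
  unfold continuous. rewrite filterlim_C_iff by apply locally_filter.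
  split; intros H eps He; apply locC_iff; auto.
Qed.

Lemma rcont_iff (f : R -> C) (t : R) :
  rcont f t <-> forall eps, (0 < eps)%R -> exists d, (0 < d)%R /\
    forall s, (Rabs (s - t) < d)%R -> (Cmod (f s - f t) < eps)%R.
Proof.
  unfold continuous. rewrite filterlim_C_iff by apply locally_filter.
  split; intros H eps He; destruct (H eps He) as [d Hd].
  - exists d. split. apply cond_pos. intros s Hs. apply Hd. exact Hs.
  - destruct Hd as [H1 H2]. exists (mkposreal d H1). intros s Hs. apply H2. exact Hs.
Qed.

Lemma Csub_self (z : C) : z - z = 0.
Proof. ring. Qed.

Lemma Cmod_sub_pos (z w : C) : w <> z -> (0 < Cmod (w - z))%R.
Proof. intros H. apply Cmod_gt_0. apply Cminus_eq_contra, H. Qed.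

(** * Continuity of complex-valued functions *)

Section Continuity.
Context {T : UniformSpace}.
Implicit Types f g : T -> C.
Notation cont := (continuous (T := T) (U := C_UniformSpace)).

Lemma cont_const (c : C) x : cont (fun _ => c) x.
Proof. apply continuous_const. Qed.

Lemma cont_plus f g x : cont f x -> cont g x -> cont (fun y => f y + g y) x.
Proof. exact (@continuous_plus T R_AbsRing C_R_NormedModule f g x). Qed.

Lemma cont_opp f x : cont f x -> cont (fun y => - f y) x.
Proof. exact (@continuous_opp T R_AbsRing C_R_NormedModule f x). Qed.

Lemma cont_minus f g x : cont f x -> cont g x -> cont (fun y => f y - g y) x.
Proof. intros Hf Hg. apply cont_plus; [|apply cont_opp]; auto. Qed.

Lemma cont_pair (u v : T -> R) x :
  continuous u x -> continuous v x -> cont (fun y => (u y, v y)) x.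
Proof.
  intros Hu Hv P [d Hd].
  assert (A : locally x (fun y => ball (u x) d (u y) /\ ball (v x) d (v y))).
  { apply filter_and; [apply Hu|apply Hv]; exists d; auto. }
  unfold filtermap. generalize A. apply filter_imp.
  intros y [H1 H2]. apply Hd. split; auto.
Qed.

Lemma cont_Re f x : cont f x -> continuous (fun y => Re (f y)) x.
Proof. intros H. apply (continuous_comp f Re). exact H. apply continuous_fst. Qed.

Lemma cont_Im f x : cont f x -> continuous (fun y => Im (f y)) x.
Proof. intros H. apply (continuous_comp f Im). exact H. apply continuous_snd. Qed.

Lemma cont_mult f g x : cont f x -> cont g x -> cont (fun y => f y * g y) x.
Proof.
  intros Hf Hg.
  pose proof (cont_Re _ _ Hf). pose proof (cont_Im _ _ Hf).
  pose proof (cont_Re _ _ Hg). pose proof (cont_Im _ _ Hg).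
  apply (cont_pair (fun y => Re (f y) * Re (g y) - Im (f y) * Im (g y))%R
                   (fun y => Re (f y) * Im (g y) + Im (f y) * Re (g y))%R).
  - apply (@continuous_minus T R_AbsRing R_NormedModule);
    apply (@continuous_mult T R_AbsRing); auto.
  - apply (@continuous_plus T R_AbsRing R_NormedModule);
    apply (@continuous_mult T R_AbsRing); auto.
Qed.

Lemma cont_ext_loc f g x : locally x (fun y => f y = g y) -> cont f x -> cont g x.
Proof. apply continuous_ext_loc. Qed.

End Continuity.

Lemma cont_inv_id (z : C) : z <> 0 -> ccont Cinv z.
Proof.
  intros Hz. apply ccont_iff. intros eps He.
  assert (Hm := proj1 (Cmod_gt_0 z) Hz). set (m := Cmod z) in *.
  assert (Hd2 : (0 < eps * m * m / 2)%R).
  { apply Rdiv_lt_0_compat; try lra. repeat apply Rmult_lt_0_compat; auto. }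
  (* The first bound forces [m / 2 < Cmod w]; the second then makes [Cmod (w - z) / (Cmod w * m)]
     smaller than [eps]. *)
  exists (Rmin (m / 2) (eps * m * m / 2)). split. apply Rmin_pos; lra.
  intros w Hw.
  assert (W1 := Rlt_le_trans _ _ _ Hw (Rmin_l _ _)).
  assert (W2 := Rlt_le_trans _ _ _ Hw (Rmin_r _ _)).
  assert (M : (m / 2 < Cmod w)%R).
  { pose proof (Cmod_triangle w (- (w - z))) as T. rewrite Cmod_opp in T.
    replace (w + - (w - z)) with z in T by ring. fold m in T. lra. }
  assert (Hw0 : w <> 0). { apply Cmod_gt_0. lra. }
  replace (/ w - / z) with (- (w - z) / (w * z)) by (field; auto).
  rewrite Cmod_div by (apply Cmult_neq_0; auto).
  rewrite Cmod_opp, Cmod_mult. fold m.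
  apply (Rmult_lt_reg_r (Cmod w * m)). nra.
  unfold Rdiv. rewrite Rmult_assoc, Rinv_l by nra. rewrite Rmult_1_r.
  apply Rlt_le_trans with (1 := W2). nra.
Qed.

Lemma cont_inv {T : UniformSpace} (f : T -> C) x :
  f x <> 0 -> continuous (T := T) (U := C_UniformSpace) f x ->
  continuous (T := T) (U := C_UniformSpace) (fun y => / f y) x.
Proof. intros H Hf. apply (continuous_comp f Cinv); auto. apply cont_inv_id, H. Qed.

Lemma cont_pow {T : UniformSpace} (f : T -> C) n x :
  continuous (T := T) (U := C_UniformSpace) f x ->
  continuous (T := T) (U := C_UniformSpace) (fun y => f y ^ n) x.
Proof.
  intros Hf. induction n; simpl. apply cont_const.
  apply cont_mult; auto.
Qed.

Lemma is_linear_C_scal (l : C) :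
  is_linear (K := C_AbsRing) (U := AbsRing_NormedModule C_AbsRing) (V := C_NormedModule) (fun y => scal y l).
Proof. exact (@is_linear_scal_l C_AbsRing C_NormedModule l). Qed.

(** In [is_derive] the variable lives in the absolute ring [C_AbsRing], whose balls are [Cmod]
    discs; [locally_C] identifies its neighbourhoods with those of [C_UniformSpace]. *)
Lemma is_cderive_iff (f : C -> C) (z l : C) :
  is_cderive f z l <-> forall eps, (0 < eps)%R -> exists d, (0 < d)%R /\
    forall w, (Cmod (w - z) < d)%R ->
      (Cmod (f w - f z - (w - z) * l) <= eps * Cmod (w - z))%R.
Proof.
  split.
  - intros [_ H] eps He.
    specialize (H z (fun P HP => HP) (mkposreal eps He)).
    apply locally_C, locC_iff in H. exact H.
  - intros H. split. apply is_linear_C_scal.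
    intros x Hx. replace x with z.
    2:{ exact (@is_filter_lim_locally_unique C_AbsRing (AbsRing_NormedModule C_AbsRing) z x Hx). }
    intros eps. destruct (H eps (cond_pos eps)) as [d [Hd Hd2]].
    exists (mkposreal d Hd). intros w Hw. apply Hd2. exact Hw.
Qed.

Lemma norm_C_R (z : C) : norm (K := R_AbsRing) (V := C_R_NormedModule) z = Cmod z.
Proof.
  unfold Cmod, norm; simpl. unfold prod_norm, norm; simpl. unfold abs; simpl.
  f_equal. rewrite !Rmult_1_r, <- !Rabs_mult, !Rabs_pos_eq; auto; apply Rle_0_sqr.
Qed.

Lemma is_rderive_iff (f : R -> C) (t : R) (l : C) :
  is_rderive f t l <-> forall eps, (0 < eps)%R -> exists d, (0 < d)%R /\
    forall s, (Rabs (s - t) < d)%R ->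
      (Cmod (f s - f t - (s - t)%R * l) <= eps * Rabs (s - t))%R.
Proof.
  split.
  - intros [_ H] eps He.
    specialize (H t (fun P HP => HP) (mkposreal eps He)).
    destruct H as [d Hd]. exists d. split. apply cond_pos.
    intros s Hs. specialize (Hd s Hs). rewrite norm_C_R in Hd.
    rewrite <- scal_R_Cmult. exact Hd.
  - intros H. split. exact (@is_linear_scal_l R_AbsRing C_R_NormedModule l).
    intros x Hx. replace x with t.
    2:{ exact (@is_filter_lim_locally_unique R_AbsRing R_NormedModule t x Hx). }
    intros eps. destruct (H eps (cond_pos eps)) as [d [Hd Hd2]].
    exists (mkposreal d Hd). intros w Hw. specialize (Hd2 w Hw).
    rewrite <- scal_R_Cmult in Hd2.
    rewrite norm_C_R. exact Hd2.
Qed.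

Section Derivatives.
Implicit Types f g : C -> C.
Implicit Types z l m c : C.

(** The difference quotient of [f] at [z], completed by [l] at [z] itself. Having derivative [l] at
    [z] amounts to continuity of this function there (Caratheodory's form), which turns the product
    and chain rules into algebra. The same function is integrated in Cauchy's formula. *)
Definition slope (f : C -> C) (z l w : C) : C :=
  if Ceq_dec w z then l else (f w - f z) / (w - z).

Lemma slope_eq f z l w : f w = f z + slope f z l w * (w - z).
Proof.
  unfold slope. destruct (Ceq_dec w z) as [->|H]. ring.
  field. apply Cminus_eq_contra, H.
Qed.

Lemma slope_self f z l : slope f z l z = l.
Proof. unfold slope. destruct (Ceq_dec z z); tauto. Qed.

Lemma is_cderive_factor (f phi : C -> C) (z : C) :
  locC z (fun w => f w = f z + phi w * (w - z)) -> ccont phi z ->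
  is_cderive f z (phi z).
Proof.
  intros H1 H2. apply is_cderive_iff. intros eps He.
  apply locC_iff in H1. destruct H1 as [d1 [Hd1 H1]].
  destruct (proj1 (ccont_iff _ _) H2 eps He) as [d2 [Hd2 H3]].
  exists (Rmin d1 d2). split. apply Rmin_pos; auto. intros w Hw.
  assert (W1 := Rlt_le_trans _ _ _ Hw (Rmin_l _ _)).
  assert (W2 := Rlt_le_trans _ _ _ Hw (Rmin_r _ _)).
  rewrite (H1 w W1).
  replace (f z + phi w * (w - z) - f z - (w - z) * phi z) with ((phi w - phi z) * (w - z)) by ring.
  rewrite Cmod_mult. apply Rmult_le_compat_r. apply Cmod_ge_0. left. auto.
Qed.

Lemma ccont_slope (f : C -> C) (z l : C) : is_cderive f z l -> ccont (slope f z l) z.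
Proof.
  intros H. apply ccont_iff. intros eps He.
  destruct (proj1 (is_cderive_iff _ _ _) H (eps / 2)%R ltac:(lra)) as [d [Hd H2]].
  exists d. split; auto. intros w Hw. rewrite slope_self. unfold slope.
  destruct (Ceq_dec w z) as [->|Hn].
  - rewrite Csub_self, Cmod_0. auto.
  - specialize (H2 w Hw). pose proof (Cmod_sub_pos _ _ Hn).
    replace ((f w - f z) / (w - z) - l) with ((f w - f z - (w - z) * l) / (w - z))
      by (field; apply Cminus_eq_contra, Hn).
    rewrite Cmod_div by (apply Cminus_eq_contra, Hn).
    apply (Rmult_lt_reg_r (Cmod (w - z))); auto.
    unfold Rdiv. rewrite Rmult_assoc, Rinv_l by lra. nra.
Qed.

Lemma locC_all (z : C) (P : C -> Prop) : (forall w, P w) -> locC z P.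
Proof. intros H. apply filter_forall, H. Qed.

Lemma ex_cderive_cont f z : ex_cderive f z -> ccont f z.
Proof.
  intros [l H]. apply (cont_ext_loc (fun w => f z + slope f z l w * (w - z))).
  - apply locC_all. intros w. symmetry. apply slope_eq.
  - apply cont_plus. apply cont_const. apply cont_mult. apply ccont_slope, H.
    apply cont_minus. apply continuous_id. apply cont_const.
Qed.

Lemma is_cderive_ext_loc f g z l :
  locC z (fun w => f w = g w) -> is_cderive f z l -> is_cderive g z l.
Proof.
  intros H. apply is_derive_ext_loc. apply locally_C. exact H.
Qed.

Lemma is_cderive_const (c z : C) : is_cderive (fun _ => c) z (RtoC 0).
Proof. exact (@is_derive_const C_AbsRing C_NormedModule c z). Qed.

Lemma is_cderive_id (z : C) : is_cderive (fun w => w) z (RtoC 1).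
Proof.
  apply (is_cderive_factor (fun w => w) (fun _ => 1)).
  apply locC_all. intros; ring. apply cont_const.
Qed.

Lemma is_cderive_plus f g z l m :
  is_cderive f z l -> is_cderive g z m -> is_cderive (fun w => f w + g w) z (l + m).
Proof. exact (@is_derive_plus C_AbsRing C_NormedModule f g z l m). Qed.

Lemma is_cderive_mult f g z l m :
  is_cderive f z l -> is_cderive g z m ->
  is_cderive (fun w => f w * g w) z (l * g z + f z * m).
Proof.
  intros Hf Hg.
  assert (Cg : ccont g z) by (apply ex_cderive_cont; exists m; auto).
  pose proof (is_cderive_factor (fun w => f w * g w)
    (fun w => slope f z l w * g w + f z * slope g z m w) z) as H.
  cbv beta in H. rewrite !slope_self in H. apply H; clear H.
  - apply locC_all. intros w. generalize (slope_eq f z l w) (slope_eq g z m w).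
    generalize (slope f z l w) (slope g z m w). intros a b Ea Eb. rewrite Ea, Eb. ring.
  - apply cont_plus; apply cont_mult; auto using cont_const, ccont_slope.
Qed.

Lemma is_cderive_comp f g z l m :
  is_cderive g z m -> is_cderive f (g z) l -> is_cderive (fun w => f (g w)) z (m * l).
Proof.
  intros Hg Hf.
  assert (Cg : ccont g z) by (apply ex_cderive_cont; exists m; auto).
  pose proof (is_cderive_factor (fun w => f (g w))
    (fun w => slope g z m w * slope f (g z) l (g w)) z) as H.
  cbv beta in H. rewrite !slope_self in H. apply H; clear H.
  - apply locC_all. intros w. generalize (slope_eq f (g z) l (g w)) (slope_eq g z m w).
    generalize (slope f (g z) l (g w)) (slope g z m w). intros a b Ea Eb.
    rewrite Ea, Eb. ring.
  - apply cont_mult. apply ccont_slope, Hg.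
    apply (continuous_comp g (slope f (g z) l)). exact Cg. apply ccont_slope, Hf.
Qed.

Lemma ccont_neq (f : C -> C) (z c : C) : ccont f z -> f z <> c -> locC z (fun w => f w <> c).
Proof.
  intros H Hc. apply locC_iff. pose proof (Cmod_sub_pos _ _ Hc) as P.
  destruct (proj1 (ccont_iff _ _) H _ P) as [d [Hd H2]].
  exists d. split; auto. intros w Hw E. specialize (H2 w Hw). rewrite E in H2.
  replace (c - f z) with (- (f z - c)) in H2 by ring. rewrite Cmod_opp in H2. lra.
Qed.

Lemma is_cderive_inv (z : C) : z <> 0 -> is_cderive Cinv z (- / z ^ 2).
Proof.
  intros Hz.
  replace (- / z ^ 2) with ((fun w => - / (w * z)) z) by (simpl; field; auto).
  apply (is_cderive_factor Cinv (fun w => - / (w * z)) z).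
  - generalize (ccont_neq (fun w => w) z 0 (continuous_id z) Hz).
    apply filter_imp. intros w Hw. field. auto.
  - apply cont_opp, cont_inv. apply Cmult_neq_0; auto.
    apply cont_mult. apply continuous_id. apply cont_const.
Qed.

Lemma is_cderive_sub_const (c z : C) : is_cderive (fun w => w - c) z (RtoC 1).
Proof.
  pose proof (is_cderive_plus _ _ _ _ _ (is_cderive_id z) (is_cderive_const (- c) z)) as H.
  rewrite Cplus_0_r in H. exact H.
Qed.

Lemma ex_cderive_const c z : ex_cderive (fun _ => c) z.
Proof. eexists. apply is_cderive_const. Qed.

Lemma ex_cderive_plus f g z : ex_cderive f z -> ex_cderive g z -> ex_cderive (fun w => f w + g w) z.
Proof. intros [l Hl] [m Hm]. eexists. apply is_cderive_plus; eauto. Qed.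

Lemma ex_cderive_mult f g z : ex_cderive f z -> ex_cderive g z -> ex_cderive (fun w => f w * g w) z.
Proof. intros [l Hl] [m Hm]. eexists. apply is_cderive_mult; eauto. Qed.

Lemma ex_cderive_opp f z : ex_cderive f z -> ex_cderive (fun w => - f w) z.
Proof. exact (@ex_derive_opp C_AbsRing C_NormedModule f z). Qed.

Lemma ex_cderive_minus f g z : ex_cderive f z -> ex_cderive g z -> ex_cderive (fun w => f w - g w) z.
Proof. intros. apply ex_cderive_plus; auto. apply ex_cderive_opp; auto. Qed.

Lemma ex_cderive_inv f z : f z <> 0 -> ex_cderive f z -> ex_cderive (fun w => / f w) z.
Proof. intros Hz [l Hl]. eexists. eapply is_cderive_comp; eauto. apply is_cderive_inv, Hz. Qed.

Lemma ex_cderive_pow f n z : ex_cderive f z -> ex_cderive (fun w => f w ^ n) z.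
Proof.
  intros H. induction n; simpl. apply ex_cderive_const. apply ex_cderive_mult; auto.
Qed.

Lemma ex_cderive_ext_loc f g z : locC z (fun w => f w = g w) -> ex_cderive f z -> ex_cderive g z.
Proof. intros H [l Hl]. exists l. eapply is_cderive_ext_loc; eauto. Qed.

(** The inner derivative is real and the outer one complex, so the two first-order estimates are
    combined by hand: the error of [F] is at most [eta] times the increment of [e], and the error of
    [e] gets multiplied by [l]. *)
Lemma is_rderive_comp (F : C -> C) (e : R -> C) (t : R) (l m : C) :
  is_rderive e t m -> is_cderive F (e t) l -> is_rderive (fun s => F (e s)) t (l * m).
Proof.
  intros He HF. apply is_rderive_iff. intros eps Heps.
  (* [K] dominates both [Cmod l] and the Lipschitz constant [Cmod m + eta] of [e] at [t]. Each of
     the two errors is then at most [eta * K * Rabs (s - t)], whence the 2 in [eta]. *)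
  set (K := (1 + Cmod l + Cmod m)%R).
  assert (K1 : (1 <= K)%R) by (pose proof (Cmod_ge_0 l); pose proof (Cmod_ge_0 m); unfold K; lra).
  set (eta := Rmin 1 (eps / (2 * K))).
  assert (Heta : (0 < eta)%R) by (apply Rmin_pos; [lra|apply Rdiv_lt_0_compat; lra]).
  assert (E1 : (eta <= 1)%R) by apply Rmin_l.
  assert (E2 : (eta * (2 * K) <= eps)%R).
  { pose proof (Rmin_r 1 (eps / (2 * K))) as E. fold eta in E.
    apply (Rmult_le_compat_r (2 * K)) in E; [|lra].
    replace (eps / (2 * K) * (2 * K))%R with eps in E by (field; lra). exact E. }
  destruct (proj1 (is_cderive_iff _ _ _) HF eta Heta) as [d1 [Hd1 H1]].
  destruct (proj1 (is_rderive_iff _ _ _) He eta Heta) as [d2 [Hd2 H2]].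
  exists (Rmin d2 (d1 / (2 * K))). split. apply Rmin_pos; auto. apply Rdiv_lt_0_compat; lra.
  intros s Hs.
  assert (W1 := Rlt_le_trans _ _ _ Hs (Rmin_l _ _)).
  assert (W2 := Rlt_le_trans _ _ _ Hs (Rmin_r _ _)).
  specialize (H2 s W1). pose proof (Rabs_pos (s - t)) as Pst.
  assert (B : (Cmod (e s - e t) <= K * Rabs (s - t))%R).
  { replace (e s - e t) with ((e s - e t - (s - t)%R * m) + (s - t)%R * m) by ring.
    eapply Rle_trans. apply Cmod_triangle. rewrite Cmod_mult, Cmod_R.
    pose proof (Cmod_ge_0 l). unfold K. nra. }
  assert (W3 : (Cmod (e s - e t) < d1)%R).
  { eapply Rle_lt_trans. apply B. apply (Rmult_lt_compat_l K) in W2; [|lra].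
    replace (K * (d1 / (2 * K)))%R with (d1 / 2)%R in W2 by (field; lra). lra. }
  specialize (H1 _ W3).
  replace (F (e s) - F (e t) - (s - t)%R * (l * m)) with
    ((F (e s) - F (e t) - (e s - e t) * l) + l * (e s - e t - (s - t)%R * m)) by ring.
  eapply Rle_trans. apply Cmod_triangle. rewrite Cmod_mult.
  pose proof (Cmod_ge_0 l). pose proof (Cmod_ge_0 m).
  assert (Cmod l <= K - 1)%R by (unfold K; lra).
  assert (eta * Cmod (e s - e t) <= eta * (K * Rabs (s - t)))%R by (apply Rmult_le_compat_l; lra).
  assert (Cmod l * Cmod (e s - e t - (s - t)%R * m) <= K * (eta * Rabs (s-t)))%R.
  { apply Rmult_le_compat; auto using Cmod_ge_0; lra. }
  assert (eta * (2 * K) * Rabs (s-t) <= eps * Rabs (s - t))%R by (apply Rmult_le_compat_r; lra).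
  nra.
Qed.

End Derivatives.

(** * Bisection and integrals of complex functions of a real variable *)

Lemma nested_point (x w : nat -> R) :
  (forall n, x n <= x (S n))%R -> (forall n, x (S n) + w (S n) <= x n + w n)%R ->
  (forall n, 0 <= w n)%R -> exists p, forall n, (x n <= p <= x n + w n)%R.
Proof.
  intros H1 H2 H3.
  assert (A1 : forall n k, (x n <= x (n + k)%nat)%R).
  { intros n k. induction k. rewrite Nat.add_0_r; lra.
    rewrite Nat.add_succ_r. specialize (H1 (n + k)%nat). lra. }
  assert (A2 : forall n k, (x (n + k)%nat + w (n + k)%nat <= x n + w n)%R).
  { intros n k. induction k. rewrite Nat.add_0_r; lra.
    rewrite Nat.add_succ_r. specialize (H2 (n + k)%nat). lra. }
  assert (A3 : forall m n, (x m <= x n + w n)%R).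
  { intros m n. specialize (A1 m n). specialize (A2 n m). rewrite Nat.add_comm in A2.
    specialize (H3 (m + n)%nat). lra. }
  destruct (completeness (fun r => exists n, r = x n)) as [p [Hp1 Hp2]].
  - exists (x O + w O)%R. intros r [n ->]. auto.
  - exists (x O), O. auto.
  - exists p. intros n. split. apply Hp1. exists n; auto.
    apply Hp2. intros r [m ->]. auto.
Qed.

(** Compactness of a rectangle in the form used here; [s] is the scale, so that [P x y s] speaks of
    the rectangle with lower left corner (x, y) and sides [L * s], [M * s]. If [P] failed at scale
    1, it would fail on some quarter, and so on; the nested failing rectangles shrink to a point,
    where the local hypothesis contradicts the failure. *)
Lemma rectangle_bisection (L M : R) (P : R -> R -> R -> Prop) (x0 y0 : R) :
  (0 <= L)%R -> (0 <= M)%R ->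
  (forall x y s, (0 < s)%R ->
    P x y (s / 2)%R -> P (x + L * (s / 2))%R y (s / 2)%R ->
    P x (y + M * (s / 2))%R (s / 2)%R ->
    P (x + L * (s / 2))%R (y + M * (s / 2))%R (s / 2)%R -> P x y s) ->
  (forall p q, (x0 <= p <= x0 + L)%R -> (y0 <= q <= y0 + M)%R ->
    exists d, (0 < d)%R /\ forall x y s, (0 < s < d)%R ->
      (x <= p <= x + L * s)%R -> (y <= q <= y + M * s)%R -> P x y s) ->
  P x0 y0 1%R.
Proof.
  intros HL HM Hstep Hloc. apply NNPP. intros Hnot.
  set (good := fun (u : R * R) (s : R) (v : R * R) =>
    ((fst v = fst u \/ fst v = fst u + L * (s / 2)) /\
     (snd v = snd u \/ snd v = snd u + M * (s / 2)) /\
     ~ P (fst v) (snd v) (s / 2))%R).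
  assert (Hex : forall u s, (0 < s)%R -> ~ P (fst u) (snd u) s -> exists v, good u s v).
  { intros [x y] s Hs HP. simpl in HP. apply NNPP. intros HN. apply HP.
    apply Hstep; auto; apply NNPP; intros HQ; apply HN.
    - exists (x, y). repeat split; simpl; auto.
    - exists ((x + L * (s / 2))%R, y). repeat split; simpl; auto.
    - exists (x, (y + M * (s / 2))%R). repeat split; simpl; auto.
    - exists ((x + L * (s / 2))%R, (y + M * (s / 2))%R). repeat split; simpl; auto. }
  (* A failing rectangle has a failing quarter. [epsilon] selects one, and [sq] iterates the choice,
     with scale [(/ 2) ^ n] after n steps. *)
  set (nxt := fun u s => epsilon (inhabits u) (good u s)).
  set (sq := fix sq n := match n with O => (x0, y0) | S n => nxt (sq n) ((/ 2) ^ n)%R end).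
  assert (Spos : forall n, (0 < (/ 2) ^ n)%R) by (intros; apply pow_lt; lra).
  assert (Hbad : forall n, ~ P (fst (sq n)) (snd (sq n)) ((/ 2) ^ n)%R /\
                           good (sq n) ((/ 2) ^ n)%R (sq (S n))).
  { induction n.
    - assert (Q : ~ P (fst (sq O)) (snd (sq O)) ((/ 2) ^ 0)%R) by (simpl; exact Hnot).
      split; auto. apply (epsilon_spec (inhabits (sq O)) (good (sq O) ((/ 2) ^ 0)%R)).
      apply Hex; auto.
    - destruct IHn as [_ [_ [_ Q]]].
      replace ((/ 2) ^ n / 2)%R with ((/ 2) ^ S n)%R in Q by (simpl; field).
      split; auto. apply (epsilon_spec (inhabits (sq (S n))) (good (sq (S n)) ((/ 2) ^ S n)%R)).
      apply Hex; auto. }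
  assert (HS : forall n, ((/ 2) ^ S n = (/ 2) ^ n / 2)%R) by (intros; simpl; field).
  destruct (nested_point (fun n => fst (sq n)) (fun n => L * (/ 2) ^ n)%R) as [p Hp].
  { intros n. destruct (Hbad n) as [_ [[E|E] _]]; rewrite E; specialize (Spos n); nra. }
  { intros n. destruct (Hbad n) as [_ [[E|E] _]]; rewrite E, HS; specialize (Spos n); nra. }
  { intros n. specialize (Spos n). nra. }
  destruct (nested_point (fun n => snd (sq n)) (fun n => M * (/ 2) ^ n)%R) as [q Hq].
  { intros n. destruct (Hbad n) as [_ [_ [[E|E] _]]]; rewrite E; specialize (Spos n); nra. }
  { intros n. destruct (Hbad n) as [_ [_ [[E|E] _]]]; rewrite E, HS; specialize (Spos n); nra. }
  { intros n. specialize (Spos n). nra. }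
  destruct (Hloc p q) as [d [Hd HP]].
  { specialize (Hp O). simpl in Hp. lra. }
  { specialize (Hq O). simpl in Hq. lra. }
  destruct (pow_lt_1_zero (/ 2) ltac:(rewrite Rabs_pos_eq; lra) d Hd) as [N HN].
  specialize (HN N (le_n N)). rewrite Rabs_pos_eq in HN by (specialize (Spos N); lra).
  apply (proj1 (Hbad N)). apply HP; auto.
Qed.

(** * Integrals over intervals and around rectangles *)

Notation CRInt := (RInt (V := C_R_CompleteNormedModule)).
Notation ex_CInt := (ex_RInt (V := C_R_NormedModule)).

Lemma CRInt_correct (f : R -> C) a b : ex_CInt f a b -> is_CInt f a b (CRInt f a b).
Proof. exact (@RInt_correct C_R_CompleteNormedModule f a b). Qed.

Lemma CRInt_unique (f : R -> C) a b I : is_CInt f a b I -> CRInt f a b = I.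
Proof. exact (@is_RInt_unique C_R_CompleteNormedModule f a b I). Qed.

Lemma is_CInt_unique (f : R -> C) a b I J : is_CInt f a b I -> is_CInt f a b J -> I = J.
Proof. intros HI HJ. rewrite <- (CRInt_unique _ _ _ _ HI). apply CRInt_unique, HJ. Qed.

Lemma ex_CInt_cont (f : R -> C) a b :
  (forall t, (Rmin a b <= t <= Rmax a b)%R -> rcont f t) -> ex_CInt f a b.
Proof. exact (@ex_RInt_continuous C_R_CompleteNormedModule f a b). Qed.

Lemma is_CInt_plus (f g : R -> C) a b I J :
  is_CInt f a b I -> is_CInt g a b J -> is_CInt (fun t => f t + g t) a b (I + J).
Proof. exact (@is_RInt_plus C_R_NormedModule f g a b I J). Qed.

Lemma is_CInt_Chasles (f : R -> C) a b c I J :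
  is_CInt f a b I -> is_CInt f b c J -> is_CInt f a c (I + J).
Proof. exact (@is_RInt_Chasles C_R_NormedModule f a b c I J). Qed.

(** The integral is linear over R by construction; for a complex factor the real and imaginary parts
    are integrated separately. *)
Lemma is_CInt_mult (f : R -> C) a b I (k : C) :
  is_CInt f a b I -> is_CInt (fun t => k * f t) a b (k * I).
Proof.
  intros H.
  pose proof (is_RInt_fct_extend_fst f a b I H) as H1.
  pose proof (is_RInt_fct_extend_snd f a b I H) as H2.
  destruct k as [k1 k2]. destruct I as [I1 I2]. simpl in H1, H2.
  apply (is_RInt_fct_extend_pair (U := R_NormedModule) (V := R_NormedModule)).
  - exact (is_RInt_minus _ _ a b _ _ (is_RInt_scal _ a b k1 _ H1) (is_RInt_scal _ a b k2 _ H2)).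
  - exact (is_RInt_plus _ _ a b _ _ (is_RInt_scal _ a b k1 _ H2) (is_RInt_scal _ a b k2 _ H1)).
Qed.

Lemma is_CInt_const a b (v : C) : is_CInt (fun _ => v) a b ((b - a)%R * v).
Proof. rewrite <- scal_R_Cmult. exact (@is_RInt_const C_R_NormedModule a b v). Qed.

Lemma is_CInt_bound (f : R -> C) a b I m :
  (forall t, (Rmin a b <= t <= Rmax a b)%R -> (Cmod (f t) <= m)%R) ->
  is_CInt f a b I -> (Cmod I <= Rabs (b - a) * m)%R.
Proof.
  assert (G : forall a b I, (a <= b)%R ->
    (forall t, (a <= t <= b)%R -> (Cmod (f t) <= m)%R) ->
    is_CInt f a b I -> (Cmod I <= Rabs (b - a) * m)%R).
  { clear a b I. intros a b I Hab H HI. rewrite <- norm_C_R, Rabs_pos_eq by lra.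
    apply (norm_RInt_le_const (V := C_R_NormedModule) f a b I m); auto.
    intros t Ht. rewrite norm_C_R. apply H, Ht. }
  intros H HI. destruct (Rle_dec a b) as [Hab|Hab].
  - apply G; auto. rewrite Rmin_left, Rmax_right in H by lra. exact H.
  - rewrite Rabs_minus_sym, <- Cmod_opp. apply G; [lra| |].
    + rewrite Rmin_right, Rmax_left in H by lra. exact H.
    + exact (@is_RInt_swap C_R_NormedModule f b a I HI).
Qed.

(** The integral of k(w) dw around the boundary of [a,b] x [c,d], counterclockwise when [a <= b] and
    [c <= d]; [Ci] is dw/dt on the vertical sides. *)
Definition rect_integral (k : C -> C) (a b c d : R) : C :=
  CRInt (fun t => k (t, c)) a b + Ci * CRInt (fun t => k (b, t)) c d
  - CRInt (fun t => k (t, d)) a b - Ci * CRInt (fun t => k (a, t)) c d.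

(** The bounds may come in any order, because rectangles will be spanned by a base point and an
    arbitrary second point. *)
Definition cont_rect (k : C -> C) (a b c d : R) : Prop :=
  forall x y, (Rmin a b <= x <= Rmax a b)%R -> (Rmin c d <= y <= Rmax c d)%R -> ccont k (x, y).

Lemma rcont_h (k : C -> C) x y : ccont k (x, y) -> rcont (fun t => k (t, y)) x.
Proof.
  intros H. apply (continuous_comp (fun t => (t, y) : C) k); auto.
  apply (cont_pair (fun t => t) (fun _ => y)). apply continuous_id. apply continuous_const.
Qed.

Lemma rcont_v (k : C -> C) x y : ccont k (x, y) -> rcont (fun t => k (x, t)) y.
Proof.
  intros H. apply (continuous_comp (fun t => (x, t) : C) k); auto.
  apply (cont_pair (fun _ => x) (fun t => t)). apply continuous_const. apply continuous_id.
Qed.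

(** * Goursat's theorem *)

Implicit Types F k : C -> C.

Lemma Cpair (x y : R) : (x, y) = x + Ci * y.
Proof. unfold Ci, Cplus, Cmult, RtoC; simpl. f_equal; ring. Qed.

Lemma Cmod_le_sum (z : C) : (Cmod z <= Rabs (Re z) + Rabs (Im z))%R.
Proof.
  destruct z as [x y]. rewrite Cpair at 1. eapply Rle_trans. apply Cmod_triangle.
  rewrite Cmod_mult, Cmod_Ci, !Cmod_R. simpl. lra.
Qed.

Lemma im_le_Cmod (z : C) : (Rabs (Im z) <= Cmod z)%R.
Proof. eapply Rle_trans. 2: apply Rmax_Cmod. apply Rmax_r. Qed.

Lemma is_CInt_FTC (F k : C -> C) (e e' : R -> C) a b :
  (forall t, (Rmin a b <= t <= Rmax a b)%R ->
     is_rderive e t (e' t) /\ rcont e' t /\ is_cderive F (e t) (k (e t)) /\ ccont k (e t)) ->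
  is_CInt (fun t => k (e t) * e' t) a b (F (e b) - F (e a)).
Proof.
  intros H.
  apply (@is_RInt_derive C_R_CompleteNormedModule (fun t => F (e t)) (fun t => k (e t) * e' t)).
  - intros t Ht. destruct (H t Ht) as [H1 [_ [H2 _]]]. apply is_rderive_comp; auto.
  - intros t Ht. destruct (H t Ht) as [H1 [H3 [_ H2]]].
    apply (cont_mult (T := R_UniformSpace)); auto. apply (continuous_comp e k); auto.
    apply (ex_derive_continuous (V := C_R_NormedModule)). exists (e' t); auto.
Qed.

Lemma is_rderive_h (y t : R) : is_rderive (fun s => (s, y)) t (RtoC 1).
Proof.
  apply is_rderive_iff. intros eps He. exists 1%R. split. lra. intros s Hs.
  match goal with |- (Cmod ?x <= _)%R => replace x with (RtoC 0) end.
  rewrite Cmod_0. pose proof (Rabs_pos (s - t)). nra.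
  rewrite !Cpair, RtoC_minus. ring.
Qed.

Lemma is_rderive_v (x t : R) : is_rderive (fun s => (x, s)) t Ci.
Proof.
  apply is_rderive_iff. intros eps He. exists 1%R. split. lra. intros s Hs.
  match goal with |- (Cmod ?x <= _)%R => replace x with (RtoC 0) end.
  rewrite Cmod_0. pose proof (Rabs_pos (s - t)). nra.
  rewrite !Cpair, RtoC_minus. ring.
Qed.

Lemma ex_CInt_h k a b c d y : cont_rect k a b c d -> (Rmin c d <= y <= Rmax c d)%R ->
  forall a' b', (Rmin a b <= a' <= Rmax a b)%R -> (Rmin a b <= b' <= Rmax a b)%R ->
  ex_CInt (fun t => k (t, y)) a' b'.
Proof.
  intros H Hy a' b' Ha Hb. apply ex_CInt_cont. intros t Ht. apply rcont_h, H; auto.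
  revert Ht. unfold Rmin, Rmax in *. repeat destruct Rle_dec; lra.
Qed.

Lemma ex_CInt_v k a b c d x : cont_rect k a b c d -> (Rmin a b <= x <= Rmax a b)%R ->
  forall c' d', (Rmin c d <= c' <= Rmax c d)%R -> (Rmin c d <= d' <= Rmax c d)%R ->
  ex_CInt (fun t => k (x, t)) c' d'.
Proof.
  intros H Hy a' b' Ha Hb. apply ex_CInt_cont. intros t Ht. apply rcont_v, H; auto.
  revert Ht. unfold Rmin, Rmax in *. repeat destruct Rle_dec; lra.
Qed.

Ltac between := unfold Rmin, Rmax in *; repeat destruct Rle_dec; lra.

Lemma CRInt_Chasles f a b c : ex_CInt f a b -> ex_CInt f b c ->
  CRInt f a c = CRInt f a b + CRInt f b c.
Proof.
  intros H1 H2. apply CRInt_unique. apply is_CInt_Chasles with b; apply CRInt_correct; auto.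
Qed.

Lemma ex_CInt_edges k a b c d : cont_rect k a b c d ->
  (ex_CInt (fun t => k (t, c)) a b /\ ex_CInt (fun t => k (t, d)) a b) /\
  ex_CInt (fun t => k (a, t)) c d /\ ex_CInt (fun t => k (b, t)) c d.
Proof.
  intros H. split; split.
  - apply (ex_CInt_h k a b c d c H); between.
  - apply (ex_CInt_h k a b c d d H); between.
  - apply (ex_CInt_v k a b c d a H); between.
  - apply (ex_CInt_v k a b c d b H); between.
Qed.

Lemma rect_split_x k a e b c d : cont_rect k a b c d -> (Rmin a b <= e <= Rmax a b)%R ->
  rect_integral k a b c d = rect_integral k a e c d + rect_integral k e b c d.
Proof.
  intros H He. unfold rect_integral.
  rewrite (CRInt_Chasles (fun t => k (t, c)) a e b), (CRInt_Chasles (fun t => k (t, d)) a e b);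
    try (eapply ex_CInt_h; [exact H| | |]; between).
  ring.
Qed.

Lemma rect_split_y k a b c e d : cont_rect k a b c d -> (Rmin c d <= e <= Rmax c d)%R ->
  rect_integral k a b c d = rect_integral k a b c e + rect_integral k a b e d.
Proof.
  intros H He. unfold rect_integral.
  rewrite (CRInt_Chasles (fun t => k (a, t)) c e d), (CRInt_Chasles (fun t => k (b, t)) c e d);
    try (eapply ex_CInt_v; [exact H| | |]; between).
  ring.
Qed.

Lemma cont_rect_sub k a b c d a' b' c' d' : cont_rect k a b c d ->
  (Rmin a b <= a' <= Rmax a b)%R -> (Rmin a b <= b' <= Rmax a b)%R ->
  (Rmin c d <= c' <= Rmax c d)%R -> (Rmin c d <= d' <= Rmax c d)%R ->
  cont_rect k a' b' c' d'.
Proof. intros H Ha Hb Hc Hd x y Hx Hy. apply H; between. Qed.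

Lemma rect_integral_plus k1 k2 a b c d : cont_rect k1 a b c d -> cont_rect k2 a b c d ->
  rect_integral (fun w => k1 w + k2 w) a b c d = rect_integral k1 a b c d + rect_integral k2 a b c d.
Proof.
  intros H1 H2.
  assert (Pl : forall f g u v, ex_CInt f u v -> ex_CInt g u v ->
    CRInt (fun t => f t + g t) u v = CRInt f u v + CRInt g u v).
  { intros f g u v Hf Hg. apply CRInt_unique. apply is_CInt_plus; apply CRInt_correct; auto. }
  destruct (ex_CInt_edges _ _ _ _ _ H1) as [[? ?] [? ?]].
  destruct (ex_CInt_edges _ _ _ _ _ H2) as [[? ?] [? ?]].
  unfold rect_integral.
  rewrite (Pl (fun t => k1 (t, c)) (fun t => k2 (t, c))),
    (Pl (fun t => k1 (t, d)) (fun t => k2 (t, d))), (Pl (fun t => k1 (a, t)) (fun t => k2 (a, t))),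
    (Pl (fun t => k1 (b, t)) (fun t => k2 (b, t))) by assumption.
  ring.
Qed.

Lemma rect_integral_ext k1 k2 a b c d :
  (forall w, k1 w = k2 w) -> rect_integral k1 a b c d = rect_integral k2 a b c d.
Proof.
  intros H. unfold rect_integral.
  assert (E : forall (u : R -> C) p q, CRInt (fun t => k1 (u t)) p q = CRInt (fun t => k2 (u t)) p q).
  { intros u p q. apply RInt_ext. intros; apply H. }
  rewrite (E (fun t => (t, c))), (E (fun t => (t, d))), (E (fun t => (a, t))), (E (fun t => (b, t))).
  reflexivity.
Qed.

Lemma rect_integral_bound k a b c d m : cont_rect k a b c d ->
  (forall x y, (Rmin a b <= x <= Rmax a b)%R -> (Rmin c d <= y <= Rmax c d)%R ->
     (Cmod (k (x, y)) <= m)%R) ->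
  (Cmod (rect_integral k a b c d) <= 2 * (Rabs (b - a) + Rabs (d - c)) * m)%R.
Proof.
  intros H Hm. unfold rect_integral, Cminus.
  assert (B1 : forall y, (Rmin c d <= y <= Rmax c d)%R ->
    (Cmod (CRInt (fun t => k (t, y)) a b) <= Rabs (b - a) * m)%R).
  { intros y Hy. apply (is_CInt_bound (fun t => k (t, y))); auto. apply CRInt_correct.
    eapply ex_CInt_h; [exact H| | |]; between. }
  assert (B2 : forall x, (Rmin a b <= x <= Rmax a b)%R ->
    (Cmod (CRInt (fun t => k (x, t)) c d) <= Rabs (d - c) * m)%R).
  { intros x Hx. apply (is_CInt_bound (fun t => k (x, t))); auto. apply CRInt_correct.
    eapply ex_CInt_v; [exact H| | |]; between. }
  pose proof (B1 c ltac:(between)). pose proof (B1 d ltac:(between)).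
  pose proof (B2 a ltac:(between)). pose proof (B2 b ltac:(between)).
  eapply Rle_trans. apply Cmod_triangle.
  eapply Rle_trans. apply Rplus_le_compat_r, Cmod_triangle.
  eapply Rle_trans. apply Rplus_le_compat_r, Rplus_le_compat_r, Cmod_triangle.
  rewrite !Cmod_opp, !Cmod_mult, Cmod_Ci. lra.
Qed.

(** On each side the integral is a difference of two corner values of [F], and these cancel around
    the boundary. *)
Lemma rect_integral_primitive F k a b c d : cont_rect k a b c d ->
  (forall x y, (Rmin a b <= x <= Rmax a b)%R -> (Rmin c d <= y <= Rmax c d)%R ->
     is_cderive F (x, y) (k (x, y))) ->
  rect_integral k a b c d = 0.
Proof.
  intros H HF. unfold rect_integral.
  assert (B1 : forall y, (Rmin c d <= y <= Rmax c d)%R ->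
    CRInt (fun t => k (t, y)) a b = F (b, y) - F (a, y)).
  { intros y Hy. apply CRInt_unique.
    apply is_RInt_ext with (f := fun t => k (t, y) * 1).
    intros; apply Cmult_1_r.
    apply (is_CInt_FTC F k (fun t => (t, y)) (fun _ => RtoC 1)).
    intros t Ht. refine (conj (is_rderive_h y t) (conj _ (conj _ _))); auto.
    apply (cont_const (T := R_UniformSpace)). }
  assert (B2 : forall x, (Rmin a b <= x <= Rmax a b)%R ->
    Ci * CRInt (fun t => k (x, t)) c d = F (x, d) - F (x, c)).
  { intros x Hx.
    assert (I : is_CInt (fun t => k (x, t) * Ci) c d (F (x, d) - F (x, c))).
    { apply (is_CInt_FTC F k (fun t => (x, t)) (fun _ => Ci)).
      intros t Ht. refine (conj (is_rderive_v x t) (conj _ (conj _ _))); auto.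
      apply (cont_const (T := R_UniformSpace)). }
    rewrite <- (CRInt_unique _ _ _ _ I).
    symmetry. apply CRInt_unique.
    apply is_RInt_ext with (f := fun t => Ci * k (x, t)).
    intros; apply Cmult_comm. apply is_CInt_mult, CRInt_correct.
    eapply ex_CInt_v; [exact H| | |]; between. }
  rewrite !B1, !B2 by between. ring.
Qed.

Lemma rect_integral_affine (al be : C) a b c d :
  rect_integral (fun w => al + be * w) a b c d = 0.
Proof.
  apply (rect_integral_primitive (fun w => al * w + be * / 2 * (w * w))).
  - intros x y _ _. apply cont_plus. apply cont_const.
    apply cont_mult. apply cont_const. apply continuous_id.
  - intros x y _ _.
    pose proof (is_cderive_plus _ _ _ _ _
      (is_cderive_mult _ _ _ _ _ (is_cderive_const al (x, y)) (is_cderive_id (x, y)))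
      (is_cderive_mult _ _ _ _ _ (is_cderive_const (be * / 2) (x, y))
        (is_cderive_mult _ _ _ _ _ (is_cderive_id (x, y)) (is_cderive_id (x, y))))) as H.
    cbv beta in H.
    match type of H with is_derive _ _ ?l => replace l with (al + be * (x, y)) in H end.
    exact H. generalize ((x, y) : C). intros w. field. 
Qed.

(** Suppose the integral has modulus m > 0. At a point of differentiability [k] is affine up to a
    small error; the affine part integrates to 0, and the error contributes at most a small multiple
    of the square of the scale. Bisection carries the bound [m / 2 * (s * s)] up to scale 1, which
    gives m <= m / 2. *)
Lemma goursat_ordered k a b c d : (a <= b)%R -> (c <= d)%R ->
  (forall x y, (a <= x <= b)%R -> (c <= y <= d)%R -> ex_cderive k (x, y)) ->
  rect_integral k a b c d = 0.
Proof.
  intros Hab Hcd Hk. apply Cmod_eq_0. apply Rle_antisym; [|apply Cmod_ge_0].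
  apply Rnot_lt_le. intros Hpos. set (m := Cmod (rect_integral k a b c d)) in *.
  set (L := (b - a)%R). set (M := (d - c)%R).
  assert (HL : (0 <= L)%R) by (unfold L; lra). assert (HM : (0 <= M)%R) by (unfold M; lra).
  (* The bisection principle quantifies over all rectangles; [inR] restricts the claim to those
     inside the given one, where [k] is differentiable. *)
  set (inR := fun x y s => (a <= x /\ x + L * s <= b /\ c <= y /\ y + M * s <= d)%R).
  assert (Hc : forall x y s, (0 <= s)%R -> inR x y s -> cont_rect k x (x + L * s) y (y + M * s)).
  { intros x y s Hs [I1 [I2 [I3 I4]]] u v Hu Hv. apply ex_cderive_cont, Hk.
    - rewrite Rmin_left, Rmax_right in Hu by nra. lra.
    - rewrite Rmin_left, Rmax_right in Hv by nra. lra. }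
  (* The bound is quadratic in [s], so four quarters at scale [s / 2] add up exactly to the bound at
     scale [s]. *)
  pose proof (rectangle_bisection L M
    (fun x y s => inR x y s ->
      (Cmod (rect_integral k x (x + L * s) y (y + M * s)) <= m / 2 * (s * s))%R) a c HL HM) as B.
  cbv beta in B.
  assert (Bd : (m <= m / 2 * (1 * 1))%R); [|lra].
  unfold m at 1.
  replace b with (a + L * 1)%R at 1 by (unfold L; ring).
  replace d with (c + M * 1)%R at 1 by (unfold M; ring).
  apply B; clear B.
  - intros x y s Hs P1 P2 P3 P4 I. pose proof (Hc x y s ltac:(lra) I) as Hcs.
    destruct I as [I1 [I2 [I3 I4]]].
    assert (0 <= L * (s / 2))%R by nra. assert (0 <= M * (s / 2))%R by nra.
    assert (EL : (x + L * s = x + L * (s / 2) + L * (s / 2))%R) by field.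
    assert (EM : (y + M * s = y + M * (s / 2) + M * (s / 2))%R) by field.
    rewrite EL, EM in *.
    rewrite (rect_split_x k _ (x + L * (s / 2))); [|auto|between].
    rewrite !(rect_split_y k _ _ y (y + M * (s / 2)) (y + M * (s / 2) + M * (s / 2)));
      try (apply (cont_rect_sub _ _ _ _ _ _ _ _ _ Hcs)); try between.
    specialize (P1 ltac:(unfold inR; lra)). specialize (P2 ltac:(unfold inR; lra)).
    specialize (P3 ltac:(unfold inR; lra)). specialize (P4 ltac:(unfold inR; lra)).
    eapply Rle_trans. apply Cmod_triangle.
    eapply Rle_trans. apply Rplus_le_compat; apply Cmod_triangle. lra.
  - intros p q Hp Hq. destruct (Hk p q) as [l Hl]; [unfold L in Hp; lra|unfold M in Hq; lra|].
    (* The perimeter [2 * (L + M) * s] times the remainder [eta * ((L + M) * s)] must not exceed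
       [m / 2 * (s * s)]. The summand 1 keeps the denominator positive for a degenerate
       rectangle. *)
    set (eta := (m / (4 * (L + M) * (L + M) + 1))%R).
    assert (HD : (0 < 4 * (L + M) * (L + M) + 1)%R) by nra.
    assert (He : (0 < eta)%R) by (apply Rdiv_lt_0_compat; lra).
    assert (He2 : (eta * (4 * (L + M) * (L + M)) <= m)%R).
    { assert ((eta * (4 * (L + M) * (L + M) + 1) = m)%R) by (unfold eta; field; lra). nra. }
    destruct (proj1 (is_cderive_iff _ _ _) Hl eta He) as [d0 [Hd0 Hd]].
    exists (d0 / (L + M + 1))%R. split. apply Rdiv_lt_0_compat; lra.
    intros x y s [Hs Hs2] Hx Hy I. pose proof (Hc x y s ltac:(lra) I) as Hcs.
    assert (Hs3 : (s * (L + M + 1) < d0)%R).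
    { apply (Rmult_lt_compat_r (L + M + 1)) in Hs2; [|lra].
      unfold Rdiv in Hs2. rewrite Rmult_assoc, Rinv_l in Hs2 by lra. lra. }
    set (P0 := ((p, q) : C)) in *.
    (* The remainder of [k] after removal of its affine approximation at [P0]. *)
    set (r := fun w => k w - (k P0 - l * P0 + l * w)).
    assert (Cr : cont_rect r x (x + L * s) y (y + M * s)).
    { intros u v Hu Hv. apply cont_minus. apply Hcs; auto.
      apply cont_plus. apply cont_const. apply cont_mult. apply cont_const. apply continuous_id. }
    replace (rect_integral k x (x + L * s) y (y + M * s)) with
      (rect_integral (fun w => r w + (k P0 - l * P0 + l * w)) x (x + L * s) y (y + M * s)).
    2:{ apply rect_integral_ext. intros w. unfold r. ring. }
    rewrite rect_integral_plus; auto.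
    2:{ intros u v _ _. apply cont_plus. apply cont_const. apply cont_mult. apply cont_const.
        apply continuous_id. }
    rewrite rect_integral_affine, Cplus_0_r.
    eapply Rle_trans. apply (rect_integral_bound r _ _ _ _ (eta * ((L + M) * s))); auto.
    + intros u v Hu Hv. rewrite Rmin_left, Rmax_right in Hu by nra.
      rewrite Rmin_left, Rmax_right in Hv by nra.
      assert (D : (Cmod ((u, v) - P0) <= (L + M) * s)%R).
      { eapply Rle_trans. apply Cmod_le_sum. unfold P0. simpl.
        apply Rle_trans with (L * s + M * s)%R; [|lra].
        apply Rplus_le_compat; apply Rabs_le; lra. }
      assert (D2 : (Cmod ((u, v) - P0) < d0)%R) by nra.
      specialize (Hd _ D2). unfold r.
      replace (k (u, v) - (k P0 - l * P0 + l * (u, v))) with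
        (k (u, v) - k P0 - ((u, v) - P0) * l) by ring.
      eapply Rle_trans. apply Hd. apply Rmult_le_compat_l; lra.
    + replace (x + L * s - x)%R with (L * s)%R by ring.
      replace (y + M * s - y)%R with (M * s)%R by ring.
      rewrite !Rabs_pos_eq by nra.
      replace (2 * (L * s + M * s) * (eta * ((L + M) * s)))%R with
        (eta * (4 * (L + M) * (L + M)) / 2 * (s * s))%R by field.
      apply Rmult_le_compat_r. nra. lra.
  - unfold inR, L, M. lra.
Qed.

(** * Primitives on boxes *)

Lemma CRInt_swap (f : R -> C) a b : ex_CInt f a b -> CRInt f b a = - CRInt f a b.
Proof.
  intros H. apply CRInt_unique.
  exact (@is_RInt_swap C_R_NormedModule f b a _ (CRInt_correct _ _ _ H)).
Qed.

Lemma rect_integral_swap_x k a b c d : cont_rect k a b c d ->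
  rect_integral k b a c d = - rect_integral k a b c d.
Proof.
  intros H. unfold rect_integral.
  rewrite (CRInt_swap (fun t => k (t, c)) a b), (CRInt_swap (fun t => k (t, d)) a b);
    try (eapply ex_CInt_h; [exact H| | |]; between).
  ring.
Qed.

Lemma rect_integral_swap_y k a b c d : cont_rect k a b c d ->
  rect_integral k a b d c = - rect_integral k a b c d.
Proof.
  intros H. unfold rect_integral.
  rewrite (CRInt_swap (fun t => k (a, t)) c d), (CRInt_swap (fun t => k (b, t)) c d);
    try (eapply ex_CInt_v; [exact H| | |]; between).
  ring.
Qed.

Lemma goursat k a b c d :
  (forall x y, (Rmin a b <= x <= Rmax a b)%R -> (Rmin c d <= y <= Rmax c d)%R ->
     ex_cderive k (x, y)) ->
  rect_integral k a b c d = 0.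
Proof.
  intros Hk.
  assert (G : forall a b, (forall x y, (Rmin a b <= x <= Rmax a b)%R ->
     (Rmin c d <= y <= Rmax c d)%R -> ex_cderive k (x, y)) -> (a <= b)%R ->
     rect_integral k a b c d = 0).
  { clear a b Hk. intros a b Hk Hab. destruct (Rle_dec c d) as [Hcd|Hcd].
    - apply goursat_ordered; auto. intros. apply Hk; between.
    - rewrite rect_integral_swap_y.
      + rewrite goursat_ordered; [ring|auto|lra|]. intros. apply Hk; between.
      + intros x y Hx Hy. apply ex_cderive_cont, Hk; between. }
  destruct (Rle_dec a b) as [Hab|Hab]; auto.
  rewrite rect_integral_swap_x.
  - rewrite G; [ring| |lra]. intros. apply Hk; between.
  - intros x y Hx Hy. apply ex_cderive_cont, Hk; between.
Qed.

Lemma CRInt_point (f : R -> C) a : CRInt f a a = RtoC 0.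
Proof. exact (@RInt_point C_R_CompleteNormedModule a f). Qed.

Lemma rect_scale a b s t : (0 <= s <= 1)%R -> (0 <= t <= 1)%R -> (s <= t)%R ->
  (Rmin (a + s * (b - a)) (a + t * (b - a)) >= Rmin a b /\
   Rmax (a + s * (b - a)) (a + t * (b - a)) <= Rmax a b)%R.
Proof.
  intros Hs Ht Hst.
  assert (forall r, (0 <= r <= 1)%R -> (Rmin a b <= a + r * (b - a) <= Rmax a b)%R).
  { intros r Hr. unfold Rmin, Rmax. destruct Rle_dec; nra. }
  pose proof (H s Hs). pose proof (H t Ht). split.
  - apply Rle_ge, Rmin_glb; lra.
  - apply Rmax_lub; lra.
Qed.

(** At the corner (a, c) only continuity is assumed. By Goursat's theorem everything except an
    arbitrarily small rectangle at that corner can be cut away; there [k] is bounded and the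
    perimeter tends to 0. *)
Lemma goursat_corner k a b c d : cont_rect k a b c d ->
  (forall x y, (Rmin a b <= x <= Rmax a b)%R -> (Rmin c d <= y <= Rmax c d)%R ->
     (x, y) <> (a, c) -> ex_cderive k (x, y)) ->
  rect_integral k a b c d = 0.
Proof.
  intros Hc Hk.
  destruct (Req_dec a b) as [<-|Hab].
  { unfold rect_integral. rewrite !CRInt_point. ring. }
  destruct (Req_dec c d) as [<-|Hcd].
  { unfold rect_integral. rewrite !CRInt_point. ring. }
  (* What lies outside the small corner rectangle is cut into two rectangles, both avoiding (a,
     c). *)
  assert (Small : forall s, (0 < s < 1)%R -> rect_integral k a b c d =
    rect_integral k a (a + s * (b - a)) c (c + s * (d - c))).
  { intros s Hs.
    set (e := (a + s * (b - a))%R). set (f := (c + s * (d - c))%R).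
    assert (He : (Rmin a b <= e <= Rmax a b)%R).
    { unfold e, Rmin, Rmax. destruct Rle_dec; nra. }
    assert (Hf : (Rmin c d <= f <= Rmax c d)%R).
    { unfold f, Rmin, Rmax. destruct Rle_dec; nra. }
    assert (Hea : (forall x, Rmin e b <= x <= Rmax e b -> x <> a)%R).
    { intros x Hx. unfold e, Rmin, Rmax in Hx. destruct Rle_dec in Hx; nra. }
    assert (Hfc : (forall y, Rmin f d <= y <= Rmax f d -> y <> c)%R).
    { intros x Hx. unfold f, Rmin, Rmax in Hx. destruct Rle_dec in Hx; nra. }
    rewrite (rect_split_x k a e b) by auto.
    rewrite (rect_split_y k a e c f d); [|apply (cont_rect_sub _ _ _ _ _ _ _ _ _ Hc); between|auto].
    rewrite (goursat k e b c d), (goursat k a e f d). ring.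
    - intros x y Hx Hy. apply Hk; try between. intros E; injection E; intros.
      apply (Hfc y); auto.
    - intros x y Hx Hy. apply Hk; try between. intros E; injection E; intros.
      apply (Hea x); auto. }
  apply Cmod_eq_0. apply Rle_antisym; [|apply Cmod_ge_0].
  apply Rnot_lt_le. intros Hpos. set (m := Cmod (rect_integral k a b c d)) in *.
  set (B := (Rabs (b - a) + Rabs (d - c))%R).
  assert (HB : (0 < B)%R).
  { pose proof (Rabs_pos_lt (b - a) ltac:(lra)). pose proof (Rabs_pos (d - c)). unfold B; lra. }
  set (N := (Cmod (k (a, c)) + 1)%R).
  assert (HN : (0 < N)%R) by (pose proof (Cmod_ge_0 (k (a, c))); unfold N; lra).
  destruct (proj1 (ccont_iff k (a, c)) (Hc a c ltac:(between) ltac:(between)) 1%R Rlt_0_1)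
    as [dl [Hdl Hd]].
  (* The three entries keep the small rectangle proper, keep it within [dl] of the corner so that
     [N] bounds [k] on it, and make the perimeter bound [2 * (s * B) * N] at most [m / 2]. *)
  set (s := Rmin (1 / 2) (Rmin (dl / (2 * B)) (m / (4 * B * N)))).
  assert (HBN : (0 < 4 * B * N)%R) by nra.
  assert (Hs0 : (0 < s)%R).
  { repeat apply Rmin_pos; try lra; apply Rdiv_lt_0_compat; lra. }
  assert (Hs1 : (s <= 1 / 2)%R) by apply Rmin_l.
  assert (Hs2 : (s * (2 * B) <= dl)%R).
  { assert (s <= dl / (2 * B))%R by (eapply Rle_trans; [apply Rmin_r|apply Rmin_l]).
    apply (Rmult_le_compat_r (2 * B)) in H; [|lra].
    replace (dl / (2 * B) * (2 * B))%R with dl in H by (field; lra). exact H. }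
  assert (Hs3 : (s * (4 * B * N) <= m)%R).
  { assert (s <= m / (4 * B * N))%R by (eapply Rle_trans; [apply Rmin_r|apply Rmin_r]).
    apply (Rmult_le_compat_r (4 * B * N)) in H; [|lra].
    replace (m / (4 * B * N) * (4 * B * N))%R with m in H by (field; nra). exact H. }
  assert (Bd : (m <= 2 * (s * B) * N)%R); [|nra].
  unfold m. rewrite (Small s) by lra.
  destruct (rect_scale a b 0 s ltac:(lra) ltac:(lra) ltac:(lra)) as [R1 R2].
  destruct (rect_scale c d 0 s ltac:(lra) ltac:(lra) ltac:(lra)) as [R3 R4].
  rewrite Rmult_0_l, Rplus_0_r in *.
  eapply Rle_trans. apply (rect_integral_bound k _ _ _ _ N).
  - intros x y Hx Hy. apply Hc; lra.
  - intros x y Hx Hy.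
    assert (D : (Cmod ((x, y) - (a, c)) < dl)%R).
    { apply Rle_lt_trans with (s * B)%R; [|nra].
      eapply Rle_trans. apply Cmod_le_sum. simpl. unfold B. rewrite Rmult_plus_distr_l.
      apply Rplus_le_compat.
      - rewrite <- (Rabs_pos_eq s) by lra. rewrite <- Rabs_mult.
        clear - Hx. unfold Rmin, Rmax, Rabs in *.
        repeat destruct Rle_dec; repeat destruct Rcase_abs; lra.
      - rewrite <- (Rabs_pos_eq s) by lra. rewrite <- Rabs_mult.
        clear - Hy. unfold Rmin, Rmax, Rabs in *.
        repeat destruct Rle_dec; repeat destruct Rcase_abs; lra. }
    specialize (Hd _ D). unfold N.
    replace (k (x, y)) with (k (a, c) + (k (x, y) - k (a, c))) by ring.
    eapply Rle_trans. apply Cmod_triangle. lra.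
  - replace (a + s * (b - a) - a)%R with (s * (b - a))%R by ring.
    replace (c + s * (d - c) - c)%R with (s * (d - c))%R by ring.
    rewrite !Rabs_mult, (Rabs_pos_eq s) by lra. unfold B. lra.
Qed.

Definition in_box (x1 x2 y1 y2 : R) (w : C) : Prop :=
  (x1 < Re w < x2)%R /\ (y1 < Im w < y2)%R.

Lemma in_box_open x1 x2 y1 y2 w : in_box x1 x2 y1 y2 w -> locC w (in_box x1 x2 y1 y2).
Proof.
  intros [[H1 H2] [H3 H4]]. apply locC_iff.
  set (d := Rmin (Rmin (Re w - x1) (x2 - Re w)) (Rmin (Im w - y1) (y2 - Im w))).
  exists d. split. repeat apply Rmin_pos; lra.
  intros v Hv. pose proof (re_le_Cmod (v - w)) as A1. pose proof (im_le_Cmod (v - w)) as A2.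
  pose proof (Rmin_l (Rmin (Re w - x1) (x2 - Re w)) (Rmin (Im w - y1) (y2 - Im w))).
  pose proof (Rmin_r (Rmin (Re w - x1) (x2 - Re w)) (Rmin (Im w - y1) (y2 - Im w))).
  pose proof (Rmin_l (Re w - x1) (x2 - Re w)). pose proof (Rmin_r (Re w - x1) (x2 - Re w)).
  pose proof (Rmin_l (Im w - y1) (y2 - Im w)). pose proof (Rmin_r (Im w - y1) (y2 - Im w)).
  fold d in H, H0. simpl in A1, A2.
  fold (Re v) (Re w) in A1. fold (Im v) (Im w) in A2.
  assert (B1 : (Rabs (Re v + - Re w) < d)%R) by (eapply Rle_lt_trans; eauto).
  assert (B2 : (Rabs (Im v + - Im w) < d)%R) by (eapply Rle_lt_trans; eauto).
  apply Rabs_def2 in B1. apply Rabs_def2 in B2. split; lra.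
Qed.

(** Integration starts at the exceptional point [z], so every rectangle spanned by [z] and another
    point of the box has [z] as a corner. [F] goes horizontally and then vertically, [F'] in the
    other order, and [goursat_corner] makes them equal. *)
Lemma primitive_on_box k x1 x2 y1 y2 z :
  in_box x1 x2 y1 y2 z ->
  (forall w, in_box x1 x2 y1 y2 w -> ccont k w) ->
  (forall w, in_box x1 x2 y1 y2 w -> w <> z -> ex_cderive k w) ->
  exists F, forall w, in_box x1 x2 y1 y2 w -> is_cderive F w (k w).
Proof.
  destruct z as [zx zy]. intros Hz Hc Hk.
  assert (CR : forall a b c d, in_box x1 x2 y1 y2 (a, c) -> in_box x1 x2 y1 y2 (b, d) ->
    cont_rect k a b c d).
  { intros a b c d [A1 A2] [B1 B2] x y Hx Hy. apply Hc. simpl in *. split; simpl; between. }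
  set (F := fun w : C => CRInt (fun t => k (t, zy)) zx (Re w)
                       + Ci * CRInt (fun t => k (Re w, t)) zy (Im w)).
  set (F' := fun w : C => CRInt (fun t => k (t, Im w)) zx (Re w)
                       + Ci * CRInt (fun t => k (zx, t)) zy (Im w)).
  assert (HF : forall w, in_box x1 x2 y1 y2 w -> F w = F' w).
  { intros [x y] Hw. pose proof (goursat_corner k zx x zy y (CR _ _ _ _ Hz Hw)) as G.
    unfold rect_integral in G. unfold F, F'. simpl.
    apply Ceq_minus. rewrite <- G. ring.
    intros u v Hu Hv Hn. apply Hk; auto. destruct Hz as [A1 A2]. destruct Hw as [B1 B2].
    simpl in *. split; simpl; between. }
  exists F. intros [x y] Hw. apply is_cderive_iff. intros eps He.
  destruct (proj1 (ccont_iff _ _) (Hc _ Hw) (eps / 2)%R ltac:(lra)) as [d1 [Hd1 H1]].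
  destruct (proj1 (locC_iff _ _) (in_box_open _ _ _ _ _ Hw)) as [d2 [Hd2 H2]].
  exists (Rmin (d1 / 2) d2). split. apply Rmin_pos; lra.
  intros [x' y'] Hw'.
  assert (W1 := Rlt_le_trans _ _ _ Hw' (Rmin_l _ _)).
  assert (W2 := H2 _ (Rlt_le_trans _ _ _ Hw' (Rmin_r _ _))).
  pose proof (re_le_Cmod ((x', y') - (x, y))) as Ax. pose proof (im_le_Cmod ((x', y') - (x, y))) as Ay.
  set (D := Cmod ((x', y') - (x, y))) in *. simpl in Ax, Ay.
  change (x' + - x)%R with (x' - x)%R in Ax. change (y' + - y)%R with (y' - y)%R in Ay.
  assert (W3 : in_box x1 x2 y1 y2 (x', y)).
  { destruct Hw, W2. split; simpl in *; lra. }
  (* The vertical increment is read off from [F] and the horizontal one from [F'], so each is an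
     integral of [k] over a single segment, on which [k] differs from [K] by at most [eps / 2]. *)
  assert (E1 : F (x', y') - F (x', y) = Ci * CRInt (fun t => k (x', t)) y y').
  { unfold F; simpl. rewrite (CRInt_Chasles (fun t => k (x', t)) zy y y'). ring.
    - eapply ex_CInt_v with (1 := CR _ _ _ _ Hz W3); between.
    - eapply ex_CInt_v with (1 := CR _ _ _ _ W3 W2); between. }
  assert (E2 : F (x', y) - F (x, y) = CRInt (fun t => k (t, y)) x x').
  { rewrite !HF by auto. unfold F'; simpl. rewrite (CRInt_Chasles (fun t => k (t, y)) zx x x'). ring.
    - eapply ex_CInt_h with (1 := CR _ _ _ _ Hz Hw); between.
    - eapply ex_CInt_h with (1 := CR _ _ _ _ Hw W3); between. }
  set (K := k (x, y)) in *.
  assert (I1 : is_CInt (fun t => k (x', t) + - K) y y' (CRInt (fun t => k (x', t)) y y' + (y' - y)%R * - K)).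
  { apply is_CInt_plus. apply CRInt_correct. eapply ex_CInt_v with (1 := CR _ _ _ _ W3 W2); between.
    apply is_CInt_const. }
  assert (I2 : is_CInt (fun t => k (t, y) + - K) x x' (CRInt (fun t => k (t, y)) x x' + (x' - x)%R * - K)).
  { apply is_CInt_plus. apply CRInt_correct. eapply ex_CInt_h with (1 := CR _ _ _ _ Hw W3); between.
    apply is_CInt_const. }
  apply is_CInt_bound with (m := (eps / 2)%R) in I1.
  apply is_CInt_bound with (m := (eps / 2)%R) in I2.
  - replace (F (x', y') - F (x, y) - ((x', y') - (x, y)) * K) with
      (Ci * (CRInt (fun t => k (x', t)) y y' + (y' - y)%R * - K)
       + (CRInt (fun t => k (t, y)) x x' + (x' - x)%R * - K)).
    2:{ replace (F (x', y') - F (x, y)) with ((F (x', y') - F (x', y)) + (F (x', y) - F (x, y))) by ring.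
        rewrite E1, E2, !Cpair, !RtoC_minus. ring. }
    eapply Rle_trans. apply Cmod_triangle. rewrite Cmod_mult, Cmod_Ci, Rmult_1_l.
    assert (Rabs (y' - y) * (eps / 2) <= D * (eps / 2))%R by (apply Rmult_le_compat_r; lra).
    assert (Rabs (x' - x) * (eps / 2) <= D * (eps / 2))%R by (apply Rmult_le_compat_r; lra).
    lra.
  - intros t Ht. left. apply H1. eapply Rle_lt_trans. apply Cmod_le_sum. simpl.
    rewrite Rplus_opp_r, Rabs_R0, Rplus_0_r.
    eapply Rle_lt_trans with (Rabs (x' - x)); [|lra]. unfold Rabs; repeat destruct Rcase_abs; between.
  - intros t Ht. left. apply H1. eapply Rle_lt_trans. apply Cmod_le_sum. simpl.
    eapply Rle_lt_trans with (Rabs (x' - x) + Rabs (y' - y))%R; [|lra].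
    apply Rplus_le_compat_l.
    unfold Rabs; repeat destruct Rcase_abs; between.
Qed.

(** * Contour integrals and winding numbers *)

Implicit Types c : R -> C.

Lemma is_rderive_Re (e : R -> C) (u : R) (l : C) : is_rderive e u l ->
  is_derive (fun s => Re (e s)) u (Re l).
Proof.
  intros H.
  pose proof (filterdiff_comp' (V := C_R_NormedModule) e Re u (fun y => scal y l) Re H
    (filterdiff_linear _ is_linear_fst)) as G.
  eapply filterdiff_ext_lin. exact G. intros y. reflexivity.
Qed.

Lemma is_rderive_Im (e : R -> C) (u : R) (l : C) : is_rderive e u l ->
  is_derive (fun s => Im (e s)) u (Im l).
Proof.
  intros H.
  pose proof (filterdiff_comp' (V := C_R_NormedModule) e Im u (fun y => scal y l) Im H
    (filterdiff_linear _ is_linear_snd)) as G.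
  eapply filterdiff_ext_lin. exact G. intros y. reflexivity.
Qed.

(** [velocity] uses two-sided derivatives of [c], so it is compared with [e'] in the interior of a
    piece, where [c] and its extension [e] agree on a neighbourhood. *)
Lemma velocity_piece c (e e' : R -> C) s t u :
  (forall v, is_rderive e v (e' v)) -> (forall v, (s <= v <= t)%R -> c v = e v) ->
  (s < u < t)%R -> velocity c u = e' u.
Proof.
  intros He Hc Hu. unfold velocity.
  assert (L : locally u (fun v => e v = c v)).
  { assert (Hd : (0 < Rmin (u - s) (t - u))%R) by (apply Rmin_pos; lra).
    exists (mkposreal _ Hd). intros v Hv. symmetry. apply Hc.
    pose proof (Rmin_l (u - s) (t - u)). pose proof (Rmin_r (u - s) (t - u)).
    change (Rabs (v - u) < Rmin (u - s) (t - u))%R in Hv.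
    apply Rabs_def2 in Hv. lra. }
  rewrite (surjective_pairing (e' u)). f_equal; apply is_derive_unique.
  - eapply is_derive_ext_loc. 2: apply is_rderive_Re, He.
    generalize L. apply filter_imp. intros v ->. reflexivity.
  - eapply is_derive_ext_loc. 2: apply is_rderive_Im, He.
    generalize L. apply filter_imp. intros v ->. reflexivity.
Qed.

(** A relation instead of the function [contour_integral]: integrability travels together with the
    value, and linearity carries no separate existence conditions. *)
Definition is_contour c k (I : C) : Prop := is_CInt (fun t => k (c t) * velocity c t) 0 1 I.

Lemma contour_integral_unique c k I : is_contour c k I -> contour_integral c k = I.
Proof. exact (@is_RInt_unique C_R_CompleteNormedModule _ 0 1 I). Qed.

Lemma is_contour_unique c k I J : is_contour c k I -> is_contour c k J -> I = J.
Proof. apply is_CInt_unique. Qed.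

Lemma is_contour_ext c k1 k2 I : (forall p, trace c p -> k1 p = k2 p) ->
  is_contour c k1 I -> is_contour c k2 I.
Proof.
  intros H. apply is_RInt_ext. intros t. rewrite Rmin_left, Rmax_right by lra. intros Ht.
  rewrite H; auto. exists t. split; auto. lra.
Qed.

Lemma is_contour_plus c k1 k2 I J : is_contour c k1 I -> is_contour c k2 J ->
  is_contour c (fun w => k1 w + k2 w) (I + J).
Proof.
  intros HI HJ. apply is_RInt_ext with (fun t => k1 (c t) * velocity c t + k2 (c t) * velocity c t).
  intros; symmetry; apply Cmult_plus_distr_r. apply is_CInt_plus; auto.
Qed.

Lemma is_contour_scal c k I (a : C) : is_contour c k I ->
  is_contour c (fun w => a * k w) (a * I).
Proof.
  intros HI. apply is_RInt_ext with (fun t => a * (k (c t) * velocity c t)).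
  intros; apply Cmult_assoc. apply is_CInt_mult; auto.
Qed.

Lemma is_contour_minus c k1 k2 I J : is_contour c k1 I -> is_contour c k2 J ->
  is_contour c (fun w => k1 w - k2 w) (I - J).
Proof.
  intros HI HJ. replace (I - J) with (I + (- (1)) * J) by ring.
  apply is_contour_ext with (fun w => k1 w + (- (1)) * k2 w). intros; ring.
  apply is_contour_plus; auto. apply is_contour_scal; auto.
Qed.

(** Hides the partition: a statement about the initial part [0,t] of the curve is extended one
    smooth piece at a time. *)
Lemma piecewise_induction c (P : R -> Prop) : piecewise_smooth c -> P 0%R ->
  (forall s t, (0 <= s < t)%R -> (t <= 1)%R -> C1_on c s t -> P s -> P t) -> P 1%R.
Proof.
  intros [n [t [H0 [H1 H]]]] P0 Hs.
  assert (G : forall i j, (i <= j <= n)%nat -> (t i <= t j)%R).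
  { intros i j. induction j; intros Hij.
    - replace i with O by lia. lra.
    - destruct (Nat.eq_dec i (S j)) as [->|]. lra.
      assert (t i <= t j)%R by (apply IHj; lia). destruct (H j) as [Hj _]. lia. lra. }
  assert (Q : forall i, (i <= n)%nat -> P (t i)).
  { induction i; intros Hi. rewrite H0; auto.
    destruct (H i) as [Hi1 Hi2]. lia.
    apply (Hs (t i)); auto.
    - split; auto. rewrite <- H0. apply G. lia.
    - rewrite <- H1. apply G. lia.
    - apply IHi. lia. }
  rewrite <- H1. apply Q. lia.
Qed.

Lemma piece_FTC c F k s t : (s < t)%R -> C1_on c s t ->
  (forall u, (s <= u <= t)%R -> is_cderive F (c u) (k (c u)) /\ ccont k (c u)) ->
  is_CInt (fun u => k (c u) * velocity c u) s t (F (c t) - F (c s)).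
Proof.
  intros Hst [e [e' [He [He' Hc]]]] H.
  apply is_RInt_ext with (fun u => k (e u) * e' u).
  - rewrite Rmin_left, Rmax_right by lra. intros u Hu.
    rewrite (velocity_piece c e e' s t) by auto. rewrite Hc by lra. reflexivity.
  - rewrite !Hc by lra. apply is_CInt_FTC.
    rewrite Rmin_left, Rmax_right by lra. intros u Hu. rewrite <- Hc by lra.
    destruct (H u Hu) as [A1 A2]. exact (conj (He u) (conj (He' u) (conj A1 A2))).
Qed.

(** Each piece contributes the increment of [F]; the sum telescopes to [F (c 1) - F (c 0)], which is
    0 on a closed curve. *)
Lemma is_contour_derivative c F k : piecewise_smooth c -> c 0%R = c 1%R ->
  (forall p, trace c p -> is_cderive F p (k p) /\ ccont k p) -> is_contour c k 0.
Proof.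
  intros Hc Hcl H. replace (RtoC 0) with (F (c 1%R) - F (c 0%R)) by (rewrite Hcl; ring).
  unfold is_contour.
  apply (piecewise_induction c (fun t =>
    is_CInt (fun u => k (c u) * velocity c u) 0 t (F (c t) - F (c 0%R))) Hc).
  - rewrite Csub_self. exact (@is_RInt_point C_R_NormedModule _ 0%R).
  - intros s t Hst Ht HC HP.
    replace (F (c t) - F (c 0%R)) with ((F (c s) - F (c 0%R)) + (F (c t) - F (c s))) by ring.
    apply is_CInt_Chasles with s; auto. apply piece_FTC; auto. lra.
    intros u Hu. apply H. exists u. split; auto. lra.
Qed.

Lemma ex_contour c k : piecewise_smooth c -> (forall p, trace c p -> ccont k p) ->
  exists I, is_contour c k I.
Proof.
  intros Hc H. unfold is_contour.
  apply (piecewise_induction c (fun t =>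
    exists I, is_CInt (fun u => k (c u) * velocity c u) 0 t I) Hc).
  - exists (RtoC 0). exact (@is_RInt_point C_R_NormedModule _ 0%R).
  - intros s t Hst Ht [e [e' [He [He' HC]]]] [I HI].
    assert (X : ex_CInt (fun u => k (e u) * e' u) s t).
    { apply ex_CInt_cont. rewrite Rmin_left, Rmax_right by lra. intros u Hu.
      apply (cont_mult (T := R_UniformSpace)); auto.
      apply (continuous_comp e k).
      - apply (ex_derive_continuous (V := C_R_NormedModule)). exists (e' u); auto.
      - rewrite <- HC by auto. apply H. exists u. split; auto. lra. }
    destruct X as [J HJ]. exists (I + J).
    apply is_CInt_Chasles with s; auto.
    apply is_RInt_ext with (fun u => k (e u) * e' u); auto.
    rewrite Rmin_left, Rmax_right by lra. intros u Hu.
    rewrite (velocity_piece c e e' s t) by auto. rewrite HC by lra. reflexivity.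
Qed.

(** Compactness of the trace. It yields both the positive distance from the curve to a point off it
    and the boundedness of the curve. *)
Lemma trace_min c (psi : C -> R) : piecewise_smooth c ->
  (forall p, continuous (T := C_UniformSpace) (U := R_UniformSpace) psi p) ->
  exists p, trace c p /\ forall q, trace c q -> (psi p <= psi q)%R.
Proof.
  intros Hc Hpsi.
  destruct (piecewise_induction c (fun t => exists u, (0 <= u <= t)%R /\
    forall v, (0 <= v <= t)%R -> (psi (c u) <= psi (c v))%R) Hc) as [u [Hu H]].
  - exists 0%R. split. lra. intros v Hv. replace v with 0%R by lra. lra.
  - intros s t Hst Ht [e [e' [He [He' HC]]]] [u [Hu H]].
    destruct (continuity_ab_min (fun v => psi (e v)) s t) as [w [Hw1 Hw2]].
    + lra.
    + intros v Hv. apply continuity_pt_filterlim.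
      apply (continuous_comp e psi); auto.
      apply (ex_derive_continuous (V := C_R_NormedModule)). exists (e' v); auto.
    + destruct (Rle_dec (psi (c u)) (psi (c w))) as [Hle|Hle].
      * exists u. split. lra. intros v Hv. destruct (Rle_dec v s). apply H; lra.
        eapply Rle_trans. apply Hle. rewrite !HC by lra. apply Hw1. lra.
      * exists w. split. lra. intros v Hv. destruct (Rle_dec v s).
        eapply Rle_trans. 2: apply H; lra. lra.
        rewrite !HC by lra. apply Hw1. lra.
  - exists (c u). split. exists u; auto. intros q [v [Hv <-]]. auto.
Qed.

Lemma continuous_Cmod_sub (p q : C) :
  continuous (T := C_UniformSpace) (U := R_UniformSpace) (fun w => Cmod (w - p)) q.
Proof.
  intros P [d Hd]. apply locC_iff. exists d. split. apply cond_pos.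
  intros w Hw. apply Hd. change (Rabs (Cmod (w - p) - Cmod (q - p)) < d)%R.
  eapply Rle_lt_trans. 2: apply Hw.
  pose proof (Cmod_triangle (w - q) (q - p)) as T1.
  pose proof (Cmod_triangle (- (w - q)) (w - p)) as T2. rewrite Cmod_opp in T2.
  replace (w - q + (q - p)) with (w - p) in T1 by ring.
  replace (- (w - q) + (w - p)) with (q - p) in T2 by ring.
  apply Rabs_le. lra.
Qed.

Lemma trace_distance c p : piecewise_smooth c -> ~ trace c p ->
  exists d, (0 < d)%R /\ forall q, trace c q -> (d <= Cmod (q - p))%R.
Proof.
  intros Hc Hp. destruct (trace_min c (fun w => Cmod (w - p)) Hc (continuous_Cmod_sub p))
    as [q [Hq H]].
  exists (Cmod (q - p)). split; auto. apply Cmod_sub_pos. intros ->. auto.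
Qed.

Lemma trace_bounded c : piecewise_smooth c -> Defs.bounded (trace c).
Proof.
  (* A minimum of minus the modulus is a point of maximal modulus. *)
  intros Hc. destruct (trace_min c (fun w => - Cmod (w - 0))%R Hc) as [q [Hq H]].
  - intros p. apply (@continuous_opp C_UniformSpace R_AbsRing R_NormedModule).
    apply (continuous_Cmod_sub 0).
  - exists (Cmod (q - 0)). intros p Hp. specialize (H p Hp).
    replace (p - 0) with p in H by ring. lra.
Qed.

(** * Winding integrals: locally constant, and zero far away *)

Lemma ccont_inv_sub (p w : C) : w <> p -> ccont (fun v => / (v - p)) w.
Proof.
  intros H. apply (cont_inv (T := C_UniformSpace) (fun v => v - p)). apply Cminus_eq_contra, H.
  apply (cont_minus (T := C_UniformSpace)). apply continuous_id. apply (cont_const (T := C_UniformSpace)).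
Qed.

Lemma ex_cderive_inv_sub (p w : C) : w <> p -> ex_cderive (fun v => / (v - p)) w.
Proof.
  intros H. apply (ex_cderive_inv (fun v => v - p)). apply Cminus_eq_contra, H.
  eexists. apply is_cderive_sub_const.
Qed.

(** A branch of the logarithm up to a constant, obtained as a primitive of 1/w. The box contains the
    disc of radius 1 about 1 and avoids 0. *)
Lemma ex_log_near_1 : exists Lg, forall w, in_box 0 2 (- 1) 1 w -> is_cderive Lg w (/ w).
Proof.
  assert (N : forall w, in_box 0 2 (- 1) 1 w -> w <> 0).
  { intros w [H _] ->. simpl in H. lra. }
  apply (primitive_on_box Cinv 0 2 (-1) 1 1).
  - split; simpl; lra.
  - intros w Hw. apply cont_inv_id, N, Hw.
  - intros w Hw _. eexists. apply is_cderive_inv, N, Hw.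
Qed.

Definition closed_curve c : Prop := piecewise_smooth c /\ c 0%R = c 1%R.

Notation winding_integral c p := (contour_integral c (fun w => / (w - p))).

Lemma is_winding c p : closed_curve c -> ~ trace c p ->
  is_contour c (fun w => / (w - p)) (winding_integral c p).
Proof.
  intros [Hc _] Hp. destruct (ex_contour c (fun w => / (w - p)) Hc) as [I HI].
  - intros q Hq. apply ccont_inv_sub. intros ->. auto.
  - rewrite (contour_integral_unique _ _ _ HI). exact HI.
Qed.

(* For q near p, log ((w - p) / (w - q)) is a primitive of
   1 / (w - p) - 1 / (w - q) along the curve. *)
Lemma winding_near c p d : closed_curve c -> (0 < d)%R ->
  (forall w, trace c w -> (d <= Cmod (w - p))%R) ->
  forall q, (Cmod (q - p) < d / 2)%R -> winding_integral c q = winding_integral c p.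
Proof.
  intros Hc Hd H q Hq. destruct ex_log_near_1 as [Lg HL].
  assert (Dq : forall w, trace c w -> (d / 2 < Cmod (w - q))%R).
  { intros w Hw. specialize (H w Hw). pose proof (Cmod_triangle (w - q) (q - p)) as T.
    replace (w - q + (q - p)) with (w - p) in T by ring. lra. }
  assert (Np : ~ trace c p).
  { intros Hp. specialize (H p Hp). rewrite Csub_self, Cmod_0 in H. lra. }
  assert (Nq : ~ trace c q).
  { intros Hp. specialize (Dq q Hp). rewrite Csub_self, Cmod_0 in Dq. lra. }
  assert (Z : is_contour c (fun w => / (w - p) - / (w - q)) 0).
  { apply (is_contour_derivative c (fun w => Lg ((w - p) * / (w - q)))); try apply Hc.
    intros w Hw.
    assert (wp : w <> p) by (intros ->; auto). assert (wq : w <> q) by (intros ->; auto).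
    assert (wp0 := Cminus_eq_contra _ _ wp). assert (wq0 := Cminus_eq_contra _ _ wq).
    split.
    - pose proof (is_cderive_mult _ _ _ _ _ (is_cderive_sub_const p w)
        (is_cderive_comp _ _ _ _ _ (is_cderive_sub_const q w) (is_cderive_inv (w - q) wq0))) as D1.
      cbv beta in D1.
      assert (B : in_box 0 2 (- 1) 1 ((w - p) * / (w - q))).
      { set (zeta := (w - p) * / (w - q)).
        (* The branch of the logarithm applies because zeta - 1 = (q - p)/(w - q), with
           [Cmod (q - p) < d / 2 < Cmod (w - q)]. *)
        assert (M : (Cmod (zeta - 1) < 1)%R).
        { replace (zeta - 1) with ((q - p) / (w - q)) by (unfold zeta; field; auto).
          rewrite Cmod_div by auto. specialize (Dq w Hw).
          apply (Rmult_lt_reg_r (Cmod (w - q))). lra.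
          unfold Rdiv. rewrite Rmult_assoc, Rinv_l by lra. lra. }
        pose proof (re_le_Cmod (zeta - 1)) as R1. pose proof (im_le_Cmod (zeta - 1)) as R2.
        unfold Cminus in R1, R2. rewrite re_plus, re_opp, re_RtoC in R1. rewrite im_plus, im_opp, im_RtoC in R2.
        assert (R3 := Rle_lt_trans _ _ _ R1 M). assert (R4 := Rle_lt_trans _ _ _ R2 M).
        apply Rabs_def2 in R3. apply Rabs_def2 in R4. split; lra. }
      pose proof (is_cderive_comp _ _ _ _ _ D1 (HL _ B)) as D2.
      match type of D2 with is_derive _ _ ?l => replace l with (/ (w - p) - / (w - q)) in D2 end.
      exact D2. field. auto.
    - apply (cont_minus (T := C_UniformSpace)); apply ccont_inv_sub; auto. }
  pose proof (is_contour_minus _ _ _ _ _ (is_winding c p Hc Np) (is_winding c q Hc Nq)) as Y.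
  pose proof (is_contour_unique _ _ _ _ Y Z) as E.
  symmetry. apply Ceq_minus, E.
Qed.

(** The open box of half side [N] contains the curve but not [p], since its points have modulus
    below [2 * N]; hence 1/(w - p) has a primitive on it. *)
Lemma winding_far c N : closed_curve c -> (forall w, trace c w -> (Cmod w < N)%R) ->
  forall p, (2 * N <= Cmod p)%R -> winding_integral c p = 0.
Proof.
  intros Hc HN p Hp.
  assert (B : forall w, in_box (- N) N (- N) N w -> w <> p).
  { intros w [[A1 A2] [A3 A4]] ->. pose proof (Cmod_le_sum p) as S.
    assert (Rabs (Re p) < N)%R by (apply Rabs_def1; lra).
    assert (Rabs (Im p) < N)%R by (apply Rabs_def1; lra). lra. }
  assert (T : forall w, trace c w -> in_box (- N) N (- N) N w).
  { intros w Hw. specialize (HN w Hw). pose proof (re_le_Cmod w). pose proof (im_le_Cmod w).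
    assert (R1 : (Rabs (Re w) < N)%R) by lra. assert (R2 : (Rabs (Im w) < N)%R) by lra.
    apply Rabs_def2 in R1. apply Rabs_def2 in R2. split; lra. }
  assert (HN0 : (0 < N)%R).
  { assert (W : trace c (c 0%R)) by (exists 0%R; split; auto; lra).
    pose proof (HN _ W). pose proof (Cmod_ge_0 (c 0%R)). lra. }
  destruct (primitive_on_box (fun w => / (w - p)) (- N) N (- N) N 0) as [F HF].
  - split; simpl; lra.
  - intros w Hw. apply ccont_inv_sub. auto.
  - intros w Hw _. apply ex_cderive_inv_sub. auto.
  - apply contour_integral_unique. apply (is_contour_derivative c F); try apply Hc.
    intros w Hw. split. apply HF, T, Hw. apply ccont_inv_sub. apply B, T, Hw.
Qed.

Lemma winding_outside c p : closed_curve c -> ~ trace c p -> ~ inside (trace c) p ->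
  winding_integral c p = 0.
Proof.
  intros Hc Hp Hin.
  destruct (trace_bounded c (proj1 Hc)) as [N HN].
  (* A point off the trace that is not enclosed has an unbounded component, so it is joined to a
     point beyond the radius required by [winding_far]. *)
  assert (Hq : exists q, joined (fun q => ~ trace c q) p q /\ (2 * (N + 1) < Cmod q)%R).
  { apply NNPP. intros HE. apply Hin. split; auto. exists (2 * (N + 1))%R.
    intros q Hq. apply Rnot_lt_le. intros Hlt. apply HE. exists q. auto. }
  destruct Hq as [q [[d [[Hd1 Hd2] [Hd3 Hd4]]] Hq]].
  rewrite <- (winding_far c (N + 1) Hc) with q.
  2:{ intros w Hw. specialize (HN w Hw). lra. } 2: lra.
  rewrite <- Hd3, <- Hd4.
  set (phi := fun t => winding_integral c (d t)).
  (* By [winding_near] the winding integral is locally constant along the path, so its derivative is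
     0; integrating that derivative compares the two ends. *)
  assert (D : is_CInt (fun _ => RtoC 0) 0 1 (phi 1%R - phi 0%R)).
  { apply (@is_RInt_derive C_R_CompleteNormedModule phi (fun _ => RtoC 0)).
    - rewrite Rmin_left, Rmax_right by lra. intros t Ht.
      destruct (trace_distance c (d t) (proj1 Hc) (Hd2 t Ht)) as [dl [Hdl H]].
      destruct (proj1 (rcont_iff _ _) (Hd1 t) (dl / 2)%R ltac:(lra)) as [r [Hr HH]].
      apply is_rderive_iff. intros eps He. exists r. split; auto. intros s Hs.
      unfold phi. rewrite (winding_near c (d t) dl Hc Hdl H (d s)) by auto.
      match goal with |- (Cmod ?x <= _)%R => replace x with (RtoC 0) by ring end.
      rewrite Cmod_0. pose proof (Rabs_pos (s - t)). nra.
    - intros t _. apply (cont_const (T := R_UniformSpace)). }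
  pose proof (is_CInt_unique _ _ _ _ _ D (is_CInt_const 0 1 0)) as E.
  rewrite Cmult_0_r in E. symmetry. apply Ceq_minus. exact E.
Qed.

(** * Cauchy's formula and partial fractions *)

(** On the curve, h(w)/(w - z) is the slope of [h] at [z] plus h(z)/(w - z). The slope is continuous
    on the box and differentiable away from [z], exactly what [primitive_on_box] asks for, so its
    integral is 0. *)
Lemma cauchy_formula_box c h x1 x2 y1 y2 z : closed_curve c ->
  (forall w, trace c w -> in_box x1 x2 y1 y2 w) -> in_box x1 x2 y1 y2 z -> ~ trace c z ->
  (forall w, in_box x1 x2 y1 y2 w -> ex_cderive h w) ->
  is_contour c (fun w => h w / (w - z)) (h z * winding_integral c z).
Proof.
  intros Hc Ht Hz Nz Hh. destruct (Hh z Hz) as [l Hl].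
  assert (K : forall w, in_box x1 x2 y1 y2 w -> w <> z -> ex_cderive (slope h z l) w).
  { intros w Hw Hn. apply ex_cderive_ext_loc with (fun v => (h v - h z) * / (v - z)).
    - generalize (ccont_neq (fun v => v) w z (continuous_id w) Hn). apply filter_imp.
      intros v Hv. unfold slope. destruct (Ceq_dec v z); tauto.
    - apply ex_cderive_mult. apply ex_cderive_minus; auto. apply ex_cderive_const.
      apply ex_cderive_inv_sub, Hn. }
  assert (KC : forall w, in_box x1 x2 y1 y2 w -> ccont (slope h z l) w).
  { intros w Hw. destruct (Ceq_dec w z) as [->|Hn]. apply ccont_slope, Hl.
    apply ex_cderive_cont; auto. }
  destruct (primitive_on_box (slope h z l) x1 x2 y1 y2 z Hz KC K) as [P HP].
  assert (Z : is_contour c (slope h z l) 0).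
  { apply (is_contour_derivative c P); try apply Hc. intros w Hw. split; auto. }
  pose proof (is_contour_plus _ _ _ _ _ Z
    (is_contour_scal _ _ _ (h z) (is_winding c z Hc Nz))) as Y.
  rewrite Cplus_0_l in Y. eapply is_contour_ext. 2: exact Y.
  intros w Hw. cbv beta. rewrite (slope_eq h z l w). field.
  apply Cminus_eq_contra. intros ->. auto.
Qed.

Lemma is_cderive_pow n z : is_cderive (fun w => w ^ S n) z (INR (S n) * z ^ n).
Proof.
  induction n.
  - simpl. replace (1 * 1) with (1 * 1 + z * 0) by ring.
    apply (is_cderive_mult (fun w => w) (fun _ => 1)). apply is_cderive_id. apply is_cderive_const.
  - pose proof (is_cderive_mult _ _ _ _ _ (is_cderive_id z) IHn) as H.
    rewrite (S_INR (S n)), RtoC_plus.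
    match type of H with is_derive _ _ ?l =>
      replace ((INR (S n) + 1) * z ^ S n) with l end.
    exact H. rewrite Cpow_S. ring.
Qed.

(** The exponent is at least 2, so there is a primitive, -1/((n+1)(w - p)^(n+1)). Exponent 1 is what
    the winding integral measures. *)
Lemma contour_inv_pow c p n : closed_curve c -> ~ trace c p ->
  is_contour c (fun w => / (w - p) ^ S (S n)) 0.
Proof.
  intros Hc Hp.
  apply (is_contour_derivative c (fun w => - / INR (S n) * (/ (w - p)) ^ S n)); try apply Hc.
  intros w Hw. assert (wp : w <> p) by (intros ->; auto).
  assert (wp0 := Cminus_eq_contra _ _ wp). split.
  - pose proof (is_cderive_mult _ _ _ _ _ (is_cderive_const (- / INR (S n)) w)
      (is_cderive_comp _ _ _ _ _
        (is_cderive_comp _ _ _ _ _ (is_cderive_sub_const p w) (is_cderive_inv (w - p) wp0))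
        (is_cderive_pow n (/ (w - p))))) as H.
    match type of H with is_derive _ _ ?l => replace (/ (w - p) ^ S (S n)) with l end.
    exact H. cbv beta. rewrite !Cpow_inv by auto. rewrite !Cpow_S. simpl (_ ^ 0).
    assert (INR (S n) <> 0 :> C).
    { intros E. apply RtoC_inj in E. revert E. apply not_0_INR. lia. }
    field. repeat split; auto. apply Cpow_nz; auto.
  - apply (cont_inv (T := C_UniformSpace) (fun w => (w - p) ^ S (S n))). apply Cpow_nz; auto.
    apply (cont_pow (T := C_UniformSpace)). apply (cont_minus (T := C_UniformSpace)).
    apply continuous_id. apply (cont_const (T := C_UniformSpace)).
Qed.

(* 1 / ((w - p)^(n+1) (w - z)) = (1 / ((w - p)^n (w - z)) - 1 / (w - p)^(n+1)) / (z - p) *)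
Lemma contour_inv_pow_div c p z n : closed_curve c -> ~ trace c p -> ~ trace c z -> z <> p ->
  is_contour c (fun w => / (w - p) ^ S n / (w - z))
    ((winding_integral c z - winding_integral c p) / (z - p) ^ S n).
Proof.
  intros Hc Hp Hz Hzp. assert (zp := Cminus_eq_contra _ _ Hzp).
  induction n.
  - pose proof (is_contour_scal _ _ _ (/ (z - p)) (is_contour_minus _ _ _ _ _
      (is_winding c z Hc Hz) (is_winding c p Hc Hp))) as H.
    match goal with |- is_contour _ _ ?l => match type of H with is_contour _ _ ?l' =>
      replace l with l' end end.
    2:{ rewrite !Cpow_S. simpl (_ ^ 0). field. auto. }
    eapply is_contour_ext. 2: exact H. intros w Hw. cbv beta.
    rewrite !Cpow_S. simpl (_ ^ 0). field. repeat split; auto; apply Cminus_eq_contra; intros ->; auto.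
  - pose proof (is_contour_scal _ _ _ (/ (z - p)) (is_contour_minus _ _ _ _ _
      IHn (contour_inv_pow c p n Hc Hp))) as H.
    match goal with |- is_contour _ _ ?l => match type of H with is_contour _ _ ?l' =>
      replace l with l' end end.
    2:{ rewrite (Cpow_S _ (S n)). field. split; auto. apply Cpow_nz; auto. }
    eapply is_contour_ext. 2: exact H. intros w Hw. cbv beta.
    assert (wp : w - p <> 0) by (apply Cminus_eq_contra; intros ->; auto).
    rewrite (Cpow_S _ (S n)). field.
    repeat split; auto; try (apply Cpow_nz; auto). apply Cminus_eq_contra; intros ->; auto.
Qed.

(** [principal_part o a z p] unfolds to [pole_part (a p) p (o p) z]. Here the number of terms is a
    separate argument, for induction, and the variable comes last. *)
Definition pole_part (b : Z -> C) (p : C) (n : nat) (z : C) : C :=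
  sum_n_m (G := C_AbelianGroup) (fun n => b (- Z.of_nat n)%Z / (z - p) ^ n) 1 n.

Lemma pole_part_0 b p z : pole_part b p 0 z = 0.
Proof. apply (sum_n_m_zero (G := C_AbelianGroup)). lia. Qed.

Lemma pole_part_S b p n z :
  pole_part b p (S n) z = pole_part b p n z + b (- Z.of_nat (S n))%Z / (z - p) ^ S n.
Proof.
  unfold pole_part. rewrite (sum_n_Sm (G := C_AbelianGroup)) by lia. reflexivity.
Qed.

Lemma contour_zero c : is_contour c (fun _ => 0) 0.
Proof.
  apply is_RInt_ext with (fun _ : R => RtoC 0).
  intros; symmetry; apply Cmult_0_l.
  pose proof (is_CInt_const 0 1 0) as H. rewrite Cmult_0_r in H. exact H.
Qed.

(** The difference of winding integrals is the same factor for every power, so the whole singular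
    part reappears at [z]. *)
Lemma contour_pole_part c b p z n : closed_curve c -> ~ trace c p -> ~ trace c z -> z <> p ->
  is_contour c (fun w => pole_part b p n w / (w - z))
    ((winding_integral c z - winding_integral c p) * pole_part b p n z).
Proof.
  intros Hc Hp Hz Hzp. induction n.
  - rewrite pole_part_0, Cmult_0_r. eapply is_contour_ext. 2: apply contour_zero.
    intros w _. cbv beta. rewrite pole_part_0. unfold Cdiv. ring.
  - pose proof (is_contour_plus _ _ _ _ _ IHn (is_contour_scal _ _ _ (b (- Z.of_nat (S n))%Z)
      (contour_inv_pow_div c p z n Hc Hp Hz Hzp))) as H.
    match goal with |- is_contour _ _ ?l => match type of H with is_contour _ _ ?l' =>
      replace l with l' end end.
    2:{ rewrite pole_part_S. unfold Cdiv. ring. }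
    eapply is_contour_ext. 2: exact H. intros w Hw. cbv beta.
    rewrite pole_part_S. unfold Cdiv. ring.
Qed.

Lemma ex_cderive_pole_part b p n w : w <> p -> ex_cderive (pole_part b p n) w.
Proof.
  intros Hw. induction n.
  - apply ex_cderive_ext_loc with (fun _ => 0).
    apply locC_all; intros; symmetry; apply pole_part_0. apply ex_cderive_const.
  - apply ex_cderive_ext_loc with
      (fun v => pole_part b p n v + b (- Z.of_nat (S n))%Z * / (v - p) ^ S n).
    apply locC_all; intros; symmetry; apply pole_part_S.
    apply ex_cderive_plus; auto. apply ex_cderive_mult. apply ex_cderive_const.
    apply (ex_cderive_inv (fun v => (v - p) ^ S n)). apply Cpow_nz, Cminus_eq_contra, Hw.
    apply (ex_cderive_pow (fun v => v - p)). eexists. apply is_cderive_sub_const.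
Qed.

(** * Laurent expansions *)

Lemma bounded_sequence (u : nat -> R) N m : (forall n, (N <= n)%nat -> (u n <= m)%R) ->
  exists B, forall n, (u n <= B)%R.
Proof.
  revert m. induction N; intros m H.
  - exists m. intros n. apply H. lia.
  - apply (IHN (Rmax m (u N))). intros n Hn. destruct (Nat.eq_dec n N) as [->|].
    apply Rmax_r. eapply Rle_trans; [apply H; lia|apply Rmax_l].
Qed.

Notation is_Cseries := (is_series (K := C_AbsRing) (V := C_NormedModule)).
Notation Csum_n := (sum_n (G := C_AbelianGroup)).

Lemma is_Cseries_iff (u : nat -> C) s : is_Cseries u s <->
  forall eps, (0 < eps)%R -> exists N, forall n, (N <= n)%nat -> (Cmod (Csum_n u n - s) < eps)%R.
Proof.
  unfold is_series. rewrite (filterlim_C_iff eventually (Csum_n u) s). reflexivity.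
Qed.

Lemma Csum_n_S (u : nat -> C) n : Csum_n u (S n) = Csum_n u n + u (S n).
Proof. exact (sum_Sn (G := C_AbelianGroup) u n). Qed.

Lemma Cseries_terms_bounded (u : nat -> C) s : is_Cseries u s ->
  exists B, forall n, (Cmod (u n) <= B)%R.
Proof.
  intros H. destruct (proj1 (is_Cseries_iff _ _) H 1%R Rlt_0_1) as [N HN].
  apply bounded_sequence with (S N) 2%R. intros [|n] Hn; [lia|].
  replace (u (S n)) with ((Csum_n u (S n) - s) - (Csum_n u n - s)) by (rewrite Csum_n_S; ring).
  unfold Cminus at 1. eapply Rle_trans. apply Cmod_triangle. rewrite Cmod_opp.
  pose proof (HN n ltac:(lia)). pose proof (HN (S n) ltac:(lia)). lra.
Qed.

(** The index shift matches the negative part in [laurent_expansion], whose n-th term has exponent n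
    + 1, with singular parts, whose sums start at 1. *)
Lemma Cseries_finite (u : nat -> C) s N : is_Cseries u s ->
  (forall n, (N <= n)%nat -> u n = 0) ->
  s = sum_n_m (G := C_AbelianGroup) (fun n => u (pred n)) 1 N.
Proof.
  intros H Hz.
  assert (E : forall k : nat, Csum_n u (N + k) = sum_n_m (G := C_AbelianGroup) (fun n => u (pred n)) 1 N).
  { intros k. induction k.
    - rewrite Nat.add_0_r. destruct N.
      + rewrite (sum_n_m_zero (G := C_AbelianGroup)) by lia.
        rewrite (sum_O (G := C_AbelianGroup)). apply Hz. lia.
      + rewrite Csum_n_S, (Hz (S N)) by lia. rewrite Cplus_0_r.
        unfold sum_n. rewrite <- (sum_n_m_S (G := C_AbelianGroup)). reflexivity.
    - rewrite Nat.add_succ_r, Csum_n_S, IHk, Hz by lia. apply Cplus_0_r. }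
  apply Ceq_minus. apply Cmod_eq_0. apply Rle_antisym; [|apply Cmod_ge_0].
  apply Rnot_lt_le. intros Hp.
  destruct (proj1 (is_Cseries_iff _ _) H _ Hp) as [K HK].
  specialize (HK (N + K)%nat ltac:(lia)). rewrite E in HK.
  rewrite <- Cmod_opp in HK. revert HK. match goal with |- (Cmod ?x < Cmod ?y)%R -> _ =>
    replace x with y by ring end. lra.
Qed.

(** With q = [Cmod u / rho] at most 1/2, the terms are dominated by B q^n, and the tail from n = 2
    on by the geometric sum 2 B q^2. *)
Lemma power_series_remainder (b : nat -> C) B u s rho :
  (0 < rho)%R -> (forall n, (Cmod (b n) * rho ^ n <= B)%R) -> (Cmod u <= rho / 2)%R ->
  is_Cseries (fun n => b n * u ^ n) s ->
  (Cmod (s - b O - u * b 1%nat) <= 2 * B * (Cmod u / rho) ^ 2)%R.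
Proof.
  intros Hr HB Hu Hs. set (q := (Cmod u / rho)%R).
  assert (Hq : (0 <= q <= 1 / 2)%R).
  { unfold q. split. apply Rdiv_le_0_compat; auto. apply Cmod_ge_0.
    apply (Rmult_le_reg_r rho); auto. unfold Rdiv. rewrite Rmult_assoc, Rinv_l by lra. lra. }
  assert (HB0 : (0 <= B)%R).
  { eapply Rle_trans. 2: apply (HB O). simpl. pose proof (Cmod_ge_0 (b O)). lra. }
  assert (HT : forall n, (Cmod (b n * u ^ n) <= B * q ^ n)%R).
  { intros n. rewrite Cmod_mult, Cmod_pow. unfold q, Rdiv. rewrite Rpow_mult_distr.
    replace (Cmod (b n) * Cmod u ^ n)%R with
      ((Cmod (b n) * rho ^ n) * (Cmod u ^ n * (/ rho) ^ n))%R.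
    2:{ transitivity (Cmod (b n) * Cmod u ^ n * (rho ^ n * (/ rho) ^ n))%R. ring.
        rewrite <- Rpow_mult_distr, Rinv_r, pow1 by lra. ring. }
    apply Rmult_le_compat_r; auto. apply Rmult_le_pos; apply pow_le. apply Cmod_ge_0.
    left; apply Rinv_0_lt_compat, Hr. }
  set (S := Csum_n (fun n => b n * u ^ n) : nat -> C).
  (* The subtracted power lets the induction close: raising n increases the bound by 2 B q^(n+2) (1
     - q), which is at least the new term B q^(n+2) because q <= 1/2. *)
  assert (HS : forall n, (Cmod (S (1 + n)%nat - b O - u * b 1%nat) <=
    2 * B * (q ^ 2 - q ^ (2 + n)))%R).
  { intros n. induction n.
    - replace (S (1 + 0)%nat - b O - u * b 1%nat) with (RtoC 0).
      rewrite Cmod_0. simpl. lra.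
      unfold S. simpl (1 + 0)%nat. rewrite Csum_n_S, (sum_O (G := C_AbelianGroup)). simpl. ring.
    - replace (1 + Datatypes.S n)%nat with (Datatypes.S (1 + n)) by lia. unfold S at 1.
      rewrite Csum_n_S. fold S.
      replace (S (1 + n)%nat + b (Datatypes.S (1 + n)) * u ^ Datatypes.S (1 + n) - b O - u * b 1%nat)
        with ((S (1 + n)%nat - b O - u * b 1%nat) + b (Datatypes.S (1 + n)) * u ^ Datatypes.S (1 + n))
        by ring.
      eapply Rle_trans. apply Cmod_triangle. specialize (HT (Datatypes.S (1 + n))).
      replace (2 + Datatypes.S n)%nat with (Datatypes.S (2 + n)) by lia.
      change (Datatypes.S (1 + n)) with (2 + n)%nat in *.
      assert (P : (0 <= q ^ (2 + n))%R) by (apply pow_le; lra).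
      change (q ^ Datatypes.S (2 + n))%R with (q * q ^ (2 + n))%R. set (Q := (q ^ (2 + n))%R) in *.
      assert (B * (q * Q) <= B * (1 / 2 * Q))%R. { apply Rmult_le_compat_l; nra. }
      lra. }
  apply Rnot_lt_le. intros Hlt.
  destruct (proj1 (is_Cseries_iff _ _) Hs (Cmod (s - b O - u * b 1%nat) - 2 * B * q ^ 2)%R
    ltac:(lra)) as [N HN].
  specialize (HN (1 + N)%nat ltac:(lia)). specialize (HS N). fold S in HN.
  assert (P : (0 <= B * q ^ (2 + N))%R) by (apply Rmult_le_pos; auto; apply pow_le; lra).
  pose proof (Cmod_triangle (- (S (1 + N)%nat - s)) (S (1 + N)%nat - b O - u * b 1%nat)) as T.
  rewrite Cmod_opp in T.
  replace (- (S (1 + N)%nat - s) + (S (1 + N)%nat - b O - u * b 1%nat)) with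
    (s - b O - u * b 1%nat) in T by ring.
  lra.
Qed.

(* [phi] is the regular part of the Laurent expansion; only its differentiability at the
   pole itself is needed. *)
Lemma pole_decomposition f p o b : pole_data f p o b ->
  exists (phi : C -> C) (r m : R), (0 < r)%R /\ ex_cderive phi p /\
    (forall w, (Cmod (w - p) < r)%R -> (Cmod (phi w) <= m)%R) /\
    (forall w, (0 < Cmod (w - p) < r)%R -> f w = phi w + pole_part b p o w).
Proof.
  intros [[r [Hr HL]] [Ho [_ Hz]]].
  assert (L : forall w, (0 < Cmod (w - p) < r)%R ->
    is_Cseries (fun n => b (Z.of_nat n) * (w - p) ^ n) (f w - pole_part b p o w)).
  { intros w Hw. destruct (HL w Hw) as [s [t [Hs [Ht E]]]].
    apply Cseries_finite with (N := o) in Ht.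
    - replace (f w - pole_part b p o w) with s; auto. rewrite E, Ht. unfold pole_part.
      rewrite (sum_n_m_ext_loc (G := C_AbelianGroup) _
        (fun n => b (- Z.of_nat n)%Z / (w - p) ^ n)). ring.
      intros [|k] Hk; [lia|]. reflexivity.
    - intros n Hn. rewrite Hz by lia. unfold Cdiv. ring. }
  set (rho := (r / 2)%R). assert (Hrho : (0 < rho)%R) by (unfold rho; lra).
  (* Convergence at the single point p + rho bounds all the numbers |b_n| rho^n. *)
  destruct (Cseries_terms_bounded _ _ (L (p + rho) ltac:(
    replace (p + rho - p) with (RtoC rho) by ring; rewrite Cmod_R, Rabs_pos_eq; unfold rho; lra)))
    as [B HB].
  assert (HB2 : forall n, (Cmod (b (Z.of_nat n)) * rho ^ n <= B)%R).
  { intros n. specialize (HB n). replace (p + rho - p) with (RtoC rho) in HB by ring.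
    rewrite Cmod_mult, Cmod_pow, Cmod_R, Rabs_pos_eq in HB by lra. exact HB. }
  assert (HB0 : (0 <= B)%R) by (eapply Rle_trans; [apply Cmod_ge_0|apply (HB O)]).
  set (phi := fun w => if Ceq_dec w p then b 0%Z else f w - pole_part b p o w).
  assert (Rem : forall w, (Cmod (w - p) <= rho / 2)%R ->
    (Cmod (phi w - b 0%Z - (w - p) * b 1%Z) <= 2 * B * (Cmod (w - p) / rho) ^ 2)%R).
  { intros w Hw. unfold phi. destruct (Ceq_dec w p) as [->|Hn].
    - rewrite (Csub_self p). match goal with |- (Cmod ?x <= _)%R => replace x with (RtoC 0) by ring end. rewrite Cmod_0.
      unfold Rdiv. rewrite Rmult_0_l. simpl. lra.
    - pose proof (Cmod_sub_pos _ _ Hn).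
      apply (power_series_remainder (fun n => b (Z.of_nat n)) B (w - p)); auto.
      apply L. unfold rho in Hw. lra. }
  exists phi, (rho / 2)%R, (2 * B + Cmod (b 0%Z) + rho * Cmod (b 1%Z))%R.
  split. lra. split; [|split].
  - exists (b 1%Z). apply is_cderive_iff. intros eps He.
    (* The remainder estimate at distance d from p is [(K - 1) * d * d], hence at most [eps * d]
       once [d < eps / K]. *)
    set (K := (2 * B / (rho * rho) + 1)%R).
    assert (HK : (1 <= K)%R).
    { unfold K. assert (0 <= 2 * B / (rho * rho))%R by (apply Rdiv_le_0_compat; nra). lra. }
    exists (Rmin (rho / 2) (eps / K)). split. apply Rmin_pos; [lra|apply Rdiv_lt_0_compat; lra].
    intros w Hw.
    assert (W1 := Rlt_le_trans _ _ _ Hw (Rmin_l _ _)).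
    assert (W2 := Rlt_le_trans _ _ _ Hw (Rmin_r _ _)).
    replace (phi p) with (b 0%Z) by (unfold phi; destruct (Ceq_dec p p); tauto).
    eapply Rle_trans. apply Rem. lra. set (d := Cmod (w - p)) in *.
    assert (D0 : (0 <= d)%R) by apply Cmod_ge_0.
    replace (2 * B * (d / rho) ^ 2)%R with ((K - 1) * d * d)%R by (unfold K; field; lra).
    apply Rmult_le_compat_r; auto.
    apply (Rmult_lt_compat_r K) in W2; [|lra].
    unfold Rdiv in W2. rewrite Rmult_assoc, Rinv_l in W2 by lra. nra.
  - intros w Hw. specialize (Rem w ltac:(lra)).
    replace (phi w) with ((phi w - b 0%Z - (w - p) * b 1%Z) + b 0%Z + (w - p) * b 1%Z) by ring.
    eapply Rle_trans. apply Cmod_triangle. eapply Rle_trans. apply Rplus_le_compat_r, Cmod_triangle.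
    rewrite Cmod_mult.
    assert (Q : (0 <= Cmod (w - p) / rho <= 1)%R).
    { split. apply Rdiv_le_0_compat; auto. apply Cmod_ge_0.
      apply (Rmult_le_reg_r rho); auto. unfold Rdiv. rewrite Rmult_assoc, Rinv_l by lra. lra. }
    assert ((Cmod (w - p) / rho) ^ 2 <= 1)%R by nra.
    assert (Cmod (w - p) * Cmod (b 1%Z) <= rho * Cmod (b 1%Z))%R.
    { apply Rmult_le_compat_r. apply Cmod_ge_0. lra. }
    nra.
  - intros w Hw. unfold phi. destruct (Ceq_dec w p) as [->|Hn].
    rewrite Csub_self, Cmod_0 in Hw. lra. ring.
Qed.

(** * Poles *)

(** Multiplying by (w - p)^n clears the denominators and leaves a polynomial, built by Horner's
    scheme, whose value at [p] is the leading coefficient. *)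
Lemma pole_part_leading b p n : (1 <= n)%nat -> exists G : C -> C,
  ccont G p /\ G p = b (- Z.of_nat n)%Z /\
  forall w, w <> p -> (w - p) ^ n * pole_part b p n w = G w.
Proof.
  intros Hn. destruct n as [|n]; [lia|]. clear Hn.
  assert (X : ccont (fun w => w - p) p).
  { apply (cont_minus (T := C_UniformSpace)). apply continuous_id.
    apply (cont_const (T := C_UniformSpace)). }
  assert (H : forall n, exists G : C -> C, ccont G p /\
    forall w, w <> p -> (w - p) ^ n * pole_part b p n w = G w).
  { induction n0 as [|k [G [HG E]]].
    - exists (fun _ => 0). split. apply (cont_const (T := C_UniformSpace)).
      intros w _. rewrite pole_part_0. ring.
    - exists (fun w => G w * (w - p) + b (- Z.of_nat (S k))%Z). split.
      + apply (cont_plus (T := C_UniformSpace)).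
        apply (cont_mult (T := C_UniformSpace)); auto. apply (cont_const (T := C_UniformSpace)).
      + intros w Hw. rewrite pole_part_S, <- E, Cpow_S by auto. field.
    repeat split; try apply Cpow_nz; apply Cminus_eq_contra, Hw. }
  destruct (H n) as [G [HG E]].
  exists (fun w => G w * (w - p) + b (- Z.of_nat (S n))%Z). split; [|split].
  - apply (cont_plus (T := C_UniformSpace)).
    apply (cont_mult (T := C_UniformSpace)); auto. apply (cont_const (T := C_UniformSpace)).
  - rewrite Csub_self. ring.
  - intros w Hw. rewrite pole_part_S, <- E, Cpow_S by auto. field.
    repeat split; try apply Cpow_nz; apply Cminus_eq_contra, Hw.
Qed.

Definition bounded_near f (p : C) : Prop :=
  exists r m : R, (0 < r)%R /\ forall w, (0 < Cmod (w - p) < r)%R -> (Cmod (f w) <= m)%R.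

Lemma ccont_bounded f p : ccont f p -> bounded_near f p.
Proof.
  intros H. destruct (proj1 (ccont_iff _ _) H 1%R Rlt_0_1) as [d [Hd Hf]].
  exists d, (Cmod (f p) + 1)%R. split; auto. intros w Hw. specialize (Hf w (proj2 Hw)).
  replace (f w) with (f p + (f w - f p)) by ring. eapply Rle_trans. apply Cmod_triangle. lra.
Qed.

(** At a pole [f] differs from its singular part by a bounded function. If [f] were bounded too, so
    would be the singular part, and (w - p)^o times it would tend to 0, whereas its limit is the
    nonzero leading coefficient. *)
Lemma bounded_near_not_pole f p : bounded_near f p -> ~ is_pole f p.
Proof.
  intros [r0 [m0 [Hr0 H0]]] [o [b Hb]].
  destruct (pole_decomposition f p o b Hb) as [phi [r1 [m1 [Hr1 [_ [H1 E1]]]]]].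
  destruct Hb as [_ [Ho [Hb _]]].
  destruct (pole_part_leading b p o Ho) as [G [HG [Gp EG]]].
  rewrite <- Gp in Hb. assert (Hpos := proj1 (Cmod_gt_0 _) Hb).
  destruct (proj1 (ccont_iff _ _) HG (Cmod (G p) / 2)%R ltac:(lra)) as [d [Hd Hc]].
  assert (M0 : (0 <= m0)%R).
  { eapply Rle_trans. apply (Cmod_ge_0 (f (p + (r0 / 2)%R))). apply H0.
    replace (p + (r0 / 2)%R - p) with (RtoC (r0 / 2)) by ring.
    rewrite Cmod_R, Rabs_pos_eq; lra. }
  assert (M1 : (0 <= m1)%R).
  { eapply Rle_trans. apply (Cmod_ge_0 (phi p)). apply H1. rewrite Csub_self, Cmod_0. auto. }
  (* The contradiction is reached at the point p + x. The bound 1 gives x^o <= x, and the last entry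
     makes [x * (m0 + m1)] at most half of [Cmod (G p)]. *)
  set (x := Rmin (Rmin (r0 / 2) (r1 / 2))
              (Rmin (Rmin (d / 2) 1) (Cmod (G p) / (2 * (m0 + m1 + 1))))).
  assert (Hx : (0 < x)%R).
  { repeat apply Rmin_pos; try lra. apply Rdiv_lt_0_compat; lra. }
  assert (X1 : (x <= r0 / 2)%R) by (eapply Rle_trans; [apply Rmin_l|apply Rmin_l]).
  assert (X2 : (x <= r1 / 2)%R) by (eapply Rle_trans; [apply Rmin_l|apply Rmin_r]).
  assert (X3 : (x <= Rmin (d / 2) 1)%R) by (eapply Rle_trans; [apply Rmin_r|apply Rmin_l]).
  assert (X4 : (x <= Cmod (G p) / (2 * (m0 + m1 + 1)))%R)
    by (eapply Rle_trans; [apply Rmin_r|apply Rmin_r]).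
  assert (X5 := Rle_trans _ _ _ X3 (Rmin_l _ _)). assert (X6 := Rle_trans _ _ _ X3 (Rmin_r _ _)).
  apply (Rmult_le_compat_r (2 * (m0 + m1 + 1))) in X4; [|lra].
  unfold Rdiv in X4. rewrite Rmult_assoc, Rinv_l in X4 by lra.
  set (w := p + x). assert (Ew : w - p = x) by (unfold w; ring).
  assert (Mw : Cmod (w - p) = x) by (rewrite Ew, Cmod_R, Rabs_pos_eq; lra).
  assert (Hw : w <> p). { intros E. rewrite E, Csub_self, Cmod_0 in Mw. lra. }
  specialize (H0 w ltac:(lra)). specialize (H1 w ltac:(lra)). specialize (E1 w ltac:(lra)).
  specialize (EG w Hw). specialize (Hc w ltac:(lra)).
  assert (B : (Cmod (pole_part b p o w) <= m0 + m1)%R).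
  { replace (pole_part b p o w) with (f w + - phi w) by (rewrite E1; ring).
    eapply Rle_trans. apply Cmod_triangle. rewrite Cmod_opp. lra. }
  assert (Bg : (Cmod (G w) <= x * (m0 + m1))%R).
  { rewrite <- EG, Cmod_mult, Cmod_pow, Mw. apply Rmult_le_compat; auto using Cmod_ge_0.
    apply pow_le; lra. destruct o as [|o]; [lia|]. simpl.
    assert (x ^ o <= 1)%R. { rewrite <- (pow1 o). apply pow_incr. lra. }
    assert (0 <= x ^ o)%R by (apply pow_le; lra). nra. }
  pose proof (Cmod_triangle (- (G w - G p)) (G w)) as T. rewrite Cmod_opp in T.
  replace (- (G w - G p) + G w) with (G p) in T by ring. lra.
Qed.

(** Near a pole, [pole_decomposition] offers only a bound for the regular part; together with the
    continuity of the singular part away from [p] this makes [f] bounded near each neighbouring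
    point, which is all that [bounded_near_not_pole] asks. *)
Lemma poles_isolated f p : meromorphic f ->
  exists d, (0 < d)%R /\ forall q, (0 < Cmod (q - p) < d)%R -> ~ is_pole f q.
Proof.
  intros Hf. destruct (Hf p) as [H|[o [b H]]].
  - apply locC_iff in H. destruct H as [d [Hd H]]. exists d. split; auto.
    intros q Hq. apply bounded_near_not_pole, ccont_bounded, ex_cderive_cont, H, Hq.
  - destruct (pole_decomposition f p o b H) as [phi [r [m [Hr [_ [Hm E]]]]]].
    exists r. split; auto. intros q Hq. apply bounded_near_not_pole.
    assert (Hqp : q <> p). { intros ->. rewrite Csub_self, Cmod_0 in Hq. lra. }
    destruct (ccont_bounded _ _ (ex_cderive_cont _ _ (ex_cderive_pole_part b p o q Hqp)))
      as [r2 [m2 [Hr2 H2]]].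
    exists (Rmin r2 (Rmin (Cmod (q - p)) (r - Cmod (q - p)))), (m + m2)%R.
    split. repeat apply Rmin_pos; lra.
    intros w [W0 W].
    assert (W1 := Rlt_le_trans _ _ _ W (Rmin_l _ _)).
    assert (W2 := Rlt_le_trans _ _ _ W (Rmin_r _ _)).
    assert (W3 := Rlt_le_trans _ _ _ W2 (Rmin_l _ _)).
    assert (W4 := Rlt_le_trans _ _ _ W2 (Rmin_r _ _)).
    pose proof (Cmod_triangle (w - q) (q - p)) as T1.
    pose proof (Cmod_triangle (- (w - q)) (w - p)) as T2. rewrite Cmod_opp in T2.
    replace (w - q + (q - p)) with (w - p) in T1 by ring.
    replace (- (w - q) + (w - p)) with (q - p) in T2 by ring.
    rewrite E by lra. eapply Rle_trans. apply Cmod_triangle.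
    apply Rplus_le_compat. apply Hm; lra. apply H2. lra.
Qed.

Lemma enumerates_sublist (l : list C) (A : C -> Prop) :
  exists l', enumerates l' (fun p => In p l /\ A p).
Proof.
  induction l as [|q l [l' [ND H]]].
  - exists nil. split. constructor. simpl. tauto.
  - destruct (excluded_middle_informative (A q /\ ~ In q l')) as [[Hq Hn]|Hn].
    + exists (q :: l'). split. constructor; auto. intros p. simpl. rewrite H.
      split; [intros [<-|[]]|intros [[<-|] ?]]; auto.
    + exists l'. split; auto. intros p. rewrite H. simpl. split; [tauto|].
      intros [[<-|Hp] Ap]; auto. split; auto.
      destruct (classic (In q l')) as [Hi|Hi]. apply H, Hi. tauto.
Qed.

(** Bisection with the property that some finite list contains all poles in the rectangle: the lists
    of four quarters are concatenated, and around each point isolation leaves at most one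
    candidate. *)
Lemma finitely_many_poles f (A : C -> Prop) : meromorphic f -> Defs.bounded A ->
  exists l, enumerates l (fun p => is_pole f p /\ A p).
Proof.
  intros Hf [M HM]. set (N := Rmax M 1).
  assert (HN : (0 < N)%R) by (eapply Rlt_le_trans; [apply Rlt_0_1|apply Rmax_r]).
  assert (HL : (0 <= 2 * N)%R) by lra.
  pose proof (rectangle_bisection (2 * N) (2 * N) (fun x y s => exists l : list C,
    forall q, is_pole f q -> (x <= Re q <= x + 2 * N * s)%R -> (y <= Im q <= y + 2 * N * s)%R ->
    In q l) (- N) (- N) HL HL) as B. cbv beta in B.
  destruct B as [l Hl].
  - intros x y s Hs [l1 H1] [l2 H2] [l3 H3] [l4 H4]. exists (l1 ++ l2 ++ l3 ++ l4).
    intros q Hq Hx Hy. rewrite !in_app_iff.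
    destruct (Rle_dec (Re q) (x + 2 * N * (s / 2))); destruct (Rle_dec (Im q) (y + 2 * N * (s / 2))).
    + left. apply H1; auto; lra.
    + right; right; left. apply H3; auto; lra.
    + right; left. apply H2; auto; lra.
    + right; right; right. apply H4; auto; lra.
  - intros p q _ _. destruct (poles_isolated f (p, q) Hf) as [d [Hd H]].
    (* The two sides of the rectangle add up to [4 * N * s], so below this scale it stays within
       distance [d] of (p, q). *)
    exists (d / (4 * N + 1))%R. split. apply Rdiv_lt_0_compat; lra.
    intros x y s [Hs Hs2] Hx Hy. exists ((p, q) :: nil). intros w Hw Wx Wy. left.
    apply NNPP. intros Hn. apply (H w); auto. split.
    + apply Cmod_sub_pos. auto.
    + apply (Rmult_lt_compat_r (4 * N + 1)) in Hs2; [|lra].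
      unfold Rdiv in Hs2. rewrite Rmult_assoc, Rinv_l in Hs2 by lra.
      eapply Rle_lt_trans. apply Cmod_le_sum. destruct w as [w1 w2]. simpl in *.
      apply Rle_lt_trans with (2 * N * s + 2 * N * s)%R; [|nra].
      apply Rplus_le_compat; apply Rabs_le; lra.
  - destruct (enumerates_sublist l (fun p => is_pole f p /\ A p)) as [l' [ND H]].
    exists l'. split; auto. intros p. rewrite H. split; [tauto|]. intros [Hp Ap].
    split; auto. specialize (HM p Ap).
    pose proof (re_le_Cmod p) as R1. pose proof (im_le_Cmod p) as R2.
    assert (MN : (M <= N)%R) by apply Rmax_l.
    apply Hl; auto.
    + pose proof (Rle_abs (Re p)). pose proof (Rle_abs (- Re p)). rewrite Rabs_Ropp in H1. lra.
    + pose proof (Rle_abs (Im p)). pose proof (Rle_abs (- Im p)). rewrite Rabs_Ropp in H1. lra.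
Qed.

(** * Sums over finite sets and removal of finitely many singularities *)

Definition csum F (l : list C) : C := fold_right Cplus 0 (map F l).

Lemma csum_app F l1 l2 : csum F (l1 ++ l2) = csum F l1 + csum F l2.
Proof.
  unfold csum. induction l1; simpl. ring. rewrite IHl1. ring.
Qed.

Lemma csum_perm F l1 l2 : Permutation l1 l2 -> csum F l1 = csum F l2.
Proof.
  unfold csum. induction 1; simpl. reflexivity. rewrite IHPermutation; auto. ring. congruence.
Qed.

Lemma enumerates_perm l1 l2 A : enumerates l1 A -> enumerates l2 A -> Permutation l1 l2.
Proof.
  intros [N1 H1] [N2 H2]. apply NoDup_Permutation; auto. intros x. rewrite H1, H2. tauto.
Qed.

(** [sum_over] sums over an enumeration selected by [epsilon]; any other enumeration is a
    permutation of it. *)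
Lemma sum_over_enum l A F : enumerates l A -> sum_over A F = csum F l.
Proof.
  intros H. unfold sum_over. apply csum_perm. apply enumerates_perm with A; auto.
  apply epsilon_spec. exists l; auto.
Qed.

Lemma enumerates_ext l (A B : C -> Prop) : (forall p, A p <-> B p) -> enumerates l A -> enumerates l B.
Proof. intros H [N E]. split; auto. intros p. rewrite E. apply H. Qed.

Lemma enumerates_app l1 l2 (A B : C -> Prop) : enumerates l1 A -> enumerates l2 B ->
  (forall p, A p -> B p -> False) -> enumerates (l1 ++ l2) (fun p => A p \/ B p).
Proof.
  intros [N1 H1] [N2 H2] D. split.
  - apply NoDup_app; auto. intros p Hp1 Hp2. apply (D p). apply H1, Hp1. apply H2, Hp2.
  - intros p. rewrite in_app_iff, H1, H2. tauto.
Qed.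

Lemma sum_over_split l (A B : C -> Prop) F : enumerates l A ->
  sum_over A F = sum_over (fun p => A p /\ B p) F + sum_over (fun p => A p /\ ~ B p) F.
Proof.
  intros Hl.
  destruct (enumerates_sublist l B) as [l1 H1].
  destruct (enumerates_sublist l (fun p => ~ B p)) as [l2 H2].
  assert (E : forall p, In p l <-> A p) by apply Hl.
  rewrite (sum_over_enum l1 (fun p => A p /\ B p)).
  2:{ apply enumerates_ext with (2 := H1). intros p. rewrite E. tauto. }
  rewrite (sum_over_enum l2 (fun p => A p /\ ~ B p)).
  2:{ apply enumerates_ext with (2 := H2). intros p. rewrite E. tauto. }
  rewrite <- csum_app. apply sum_over_enum.
  apply enumerates_ext with (fun p => (In p l /\ B p) \/ (In p l /\ ~ B p)).
  - intros p. rewrite E. destruct (classic (B p)); tauto.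
  - apply enumerates_app; auto. tauto.
Qed.

Lemma sum_over_ext l (A B : C -> Prop) F : (forall p, A p <-> B p) -> enumerates l A ->
  sum_over A F = sum_over B F.
Proof.
  intros H Hl. rewrite (sum_over_enum l A), (sum_over_enum l B); auto.
  apply enumerates_ext with A; auto.
Qed.

(* [P q] is the singular part of [f] at [q]: [f - P q] extends differentiably to [q]. *)
Lemma remove_singularities (U : C -> Prop) (P : C -> C -> C) l : NoDup l ->
  (forall q w, w <> q -> ex_cderive (P q) w) ->
  forall f : C -> C, (forall w, U w -> ~ In w l -> ex_cderive f w) ->
  (forall q, In q l -> exists phi : C -> C, ex_cderive phi q /\
     exists r, (0 < r)%R /\ forall w, (0 < Cmod (w - q) < r)%R -> f w = phi w + P q w) ->
  exists h : C -> C, (forall w, U w -> ex_cderive h w) /\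
    forall w, ~ In w l -> f w = h w + csum (fun q => P q w) l.
Proof.
  intros ND HP. induction ND as [|q l Hq ND IH]; intros f Hf Hs.
  - exists f. split. intros w Hw. apply Hf; auto. intros w _. unfold csum; simpl. ring.
  - destruct (Hs q (or_introl eq_refl)) as [phi [Hphi [r [Hr E]]]].
    (* One singular part is subtracted and the hole at [q] is filled with the value of the regular
       part. *)
    set (f1 := fun w => if Ceq_dec w q then phi q else f w - P q w).
    assert (F1 : forall w, w <> q -> f1 w = f w - P q w).
    { intros w Hw. unfold f1. destruct (Ceq_dec w q); tauto. }
    destruct (IH f1) as [h [Hh1 Hh2]].
    + intros w Hw Hn. destruct (Ceq_dec w q) as [->|Hwq].
      * apply ex_cderive_ext_loc with phi; auto. apply locC_iff. exists r. split; auto.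
        intros w Hwr. unfold f1. destruct (Ceq_dec w q) as [->|Hwq]; auto.
        rewrite E. ring. split; auto. apply Cmod_sub_pos, Hwq.
      * apply ex_cderive_ext_loc with (fun v => f v - P q v).
        -- generalize (ccont_neq (fun v => v) w q (continuous_id w) Hwq). apply filter_imp.
           intros v Hv. rewrite F1; auto.
        -- apply ex_cderive_minus; auto. apply Hf; auto. simpl. intros [->|]; auto.
    + intros q' Hq'. assert (Hn : q' <> q) by (intros ->; auto).
      destruct (Hs q' (or_intror Hq')) as [phi' [Hphi' [r' [Hr' E']]]].
      (* Seen from another singular point [q'], the term [P q] is differentiable and joins the
         regular part; the radius below keeps [q] out of the disc. *)
      exists (fun w => phi' w - P q w). split. apply ex_cderive_minus; auto.
      exists (Rmin r' (Cmod (q' - q))). split. apply Rmin_pos; auto. apply Cmod_sub_pos, Hn.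
      intros w [W0 W].
      assert (W1 := Rlt_le_trans _ _ _ W (Rmin_l _ _)).
      assert (W2 := Rlt_le_trans _ _ _ W (Rmin_r _ _)).
      rewrite F1, E' by (auto || intros ->;
        replace (q - q') with (- (q' - q)) in W2 by ring; rewrite Cmod_opp in W2; lra). ring.
    + exists h. split; auto. intros w Hw. simpl in Hw. unfold csum; simpl.
      fold (csum (fun q => P q w) l).
      assert (Hwq : w <> q) by (intros ->; auto).
      specialize (Hh2 w ltac:(auto)). rewrite F1 in Hh2 by auto.
      replace (f w) with ((f w - P q w) + P q w) by ring. rewrite Hh2. ring.
Qed.

Lemma contour_list_sum c (P : C -> C -> C) (I : C -> C) z l :
  (forall q, In q l -> is_contour c (fun w => P q w / (w - z)) (I q)) ->
  is_contour c (fun w => csum (fun q => P q w) l / (w - z)) (csum I l).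
Proof.
  induction l; intros H; unfold csum; simpl.
  - eapply is_contour_ext. 2: apply contour_zero. intros w _. unfold Cdiv. ring.
  - eapply is_contour_ext.
    2:{ apply is_contour_plus. apply H. left; reflexivity. apply IHl. intros; apply H; right; auto. }
    intros w _. unfold csum, Cdiv. ring.
Qed.

(** * Finite sums and the integral of a meromorphic function *)

Lemma csum_scal F G (t : C) l : (forall q, In q l -> F q = t * G q) ->
  csum F l = t * csum G l.
Proof.
  unfold csum. induction l as [|q l IH]; intros H; simpl. ring.
  rewrite H by (left; auto). rewrite IH by (intros; apply H; right; auto). ring.
Qed.

Lemma two_PI_Ci_nz : 2 * PI * Ci <> 0.
Proof.
  assert (PI <> 0 :> C) by (intros E; apply RtoC_inj in E; pose proof PI_RGT_0; lra).
  repeat apply Cmult_neq_0; auto using Ci_nz. intros E; apply RtoC_inj in E; lra.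
Qed.

Lemma winding_integral_number c p : closed_curve c -> ~ trace c p ->
  winding_integral c p = 2 * PI * Ci * winding_number c p.
Proof.
  intros Hc Hp. unfold winding_number, cauchy_integral.
  rewrite (contour_integral_unique c (fun w => 1 / (w - p)) (winding_integral c p)).
  - rewrite Cmult_assoc, Cinv_r, Cmult_1_l. reflexivity. apply two_PI_Ci_nz.
  - eapply is_contour_ext. 2: apply is_winding; auto.
    intros w _. unfold Cdiv. rewrite Cmult_1_l. reflexivity.
Qed.

Lemma in_box_of_Cmod N w : (Cmod w < N)%R -> in_box (- N) N (- N) N w.
Proof.
  intros H. pose proof (re_le_Cmod w) as R1. pose proof (im_le_Cmod w) as R2.
  assert (R3 := Rle_lt_trans _ _ _ R1 H). assert (R4 := Rle_lt_trans _ _ _ R2 H).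
  apply Rabs_def2 in R3. apply Rabs_def2 in R4. split; lra.
Qed.

Lemma in_box_bounded x1 x2 y1 y2 : Defs.bounded (in_box x1 x2 y1 y2).
Proof.
  exists (Rabs x1 + Rabs x2 + (Rabs y1 + Rabs y2))%R. intros p [H1 H2].
  eapply Rle_trans. apply Cmod_le_sum.
  apply Rplus_le_compat; unfold Rabs; repeat destruct Rcase_abs; lra.
Qed.

(** The identity at one fixed region, with no limit involved: the function g_m differs from f by
    exactly the singular parts of the enclosed poles. *)
Lemma cauchy_integral_meromorphic (f : C -> C) (o : C -> nat) (a : C -> Z -> C) (A : C -> Prop) c z :
  meromorphic f -> (forall p, is_pole f p -> pole_data f p (o p) (a p)) ->
  region A c -> (forall p, trace c p -> ~ is_pole f p) -> A z -> ~ is_pole f z ->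
  f z = cauchy_integral c f z + sum_over (fun p => is_pole f p /\ A p) (principal_part o a z).
Proof.
  intros Hf Hp [[MA HA] [_ [_ [Hpw [[Hcl _] [_ [Hin Hw]]]]]]] Ht Az Nz.
  assert (Hc : closed_curve c) by (split; auto).
  destruct (trace_bounded c Hpw) as [MT HT].
  (* The box must contain the region as well as its contour; the poles it picks up outside the
     region form [l2] below. *)
  set (N := (Rmax MA MT + 1)%R). set (U := in_box (- N) N (- N) N).
  assert (UA : forall p, A p -> U p).
  { intros p Ap. apply in_box_of_Cmod. specialize (HA p Ap). pose proof (Rmax_l MA MT).
    unfold N. lra. }
  assert (UT : forall p, trace c p -> U p).
  { intros p Tp. apply in_box_of_Cmod. specialize (HT p Tp). pose proof (Rmax_r MA MT).
    unfold N. lra. }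
  assert (AT : forall p, A p -> ~ trace c p) by (intros p Ap; apply Hin, Ap).
  destruct (finitely_many_poles f U Hf (in_box_bounded _ _ _ _)) as [l [ND Hl]].
  set (P := fun q => pole_part (a q) q (o q)).
  destruct (remove_singularities U P l ND) with (f := f) as [h [Hh E]].
  { intros q w Hn. apply ex_cderive_pole_part, Hn. }
  { intros w Uw Hn. destruct (Hf w) as [H|H].
    - apply locC_iff in H. destruct H as [d [Hd H]]. apply H. rewrite Csub_self, Cmod_0. exact Hd.
    - destruct Hn. apply Hl. auto. }
  { intros q Hq. destruct (pole_decomposition f q (o q) (a q)) as [phi [r [m [Hr [H1 [_ H2]]]]]].
    apply Hp, Hl, Hq. exists phi. split; auto. exists r. auto. }
  set (T := 2 * PI * Ci).
  set (I := fun q => (winding_integral c z - winding_integral c q) * P q z).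
  assert (HI : is_contour c (fun w => f w / (w - z)) (h z * winding_integral c z + csum I l)).
  { pose proof (is_contour_plus _ _ _ _ _
      (cauchy_formula_box c h _ _ _ _ z Hc UT (UA z Az) (AT z Az) Hh)
      (contour_list_sum c P I z l ltac:(
         intros q Hq; apply Hl in Hq; destruct Hq as [Pq _]; apply contour_pole_part; auto;
         [intros Tq; apply (Ht q Tq Pq)|intros ->; auto]))) as Y.
    eapply is_contour_ext. 2: exact Y. intros w Tw. cbv beta.
    rewrite (E w). unfold Cdiv. ring. intros Hi. apply Hl in Hi. apply (Ht w Tw), Hi. }
  assert (El : enumerates l (fun p => is_pole f p /\ U p)) by (split; auto).
  destruct (enumerates_sublist l A) as [l1 H1].
  destruct (enumerates_sublist l (fun p => ~ A p)) as [l2 H2].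
  assert (Pl : Permutation l (l1 ++ l2)).
  { apply enumerates_perm with (fun p => In p l). split; auto; tauto.
    apply enumerates_ext with (fun p => (In p l /\ A p) \/ (In p l /\ ~ A p)).
    intros p. destruct (classic (A p)); tauto. apply enumerates_app; auto. tauto. }
  assert (Wz : winding_integral c z = T).
  { rewrite winding_integral_number by auto. rewrite Hw by auto. apply Cmult_1_r. }
  (* An enclosed pole has the same winding integral as [z], so its contribution vanishes; for the
     poles in [l2] the factor is the full 2 pi i. *)
  assert (I1 : csum I l1 = 0 * csum (fun q => P q z) l1).
  { apply csum_scal. intros q Hq. apply H1 in Hq. destruct Hq as [_ Aq].
    unfold I. rewrite Wz, winding_integral_number by auto. rewrite Hw by auto.
    fold T. ring. }
  assert (I2 : csum I l2 = T * csum (fun q => P q z) l2).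
  { apply csum_scal. intros q Hq. apply H2 in Hq. destruct Hq as [Lq Aq].
    apply Hl in Lq. destruct Lq as [Pq _]. unfold I. rewrite Wz, (winding_outside c q Hc).
    ring. intros Tq. apply (Ht q Tq Pq). rewrite <- Hin. exact Aq. }
  unfold cauchy_integral. fold T. rewrite (contour_integral_unique _ _ _ HI).
  rewrite (csum_perm I _ _ Pl), csum_app, I1, I2, Wz.
  rewrite (sum_over_enum l1).
  2:{ apply enumerates_ext with (2 := H1). intros p. rewrite Hl. specialize (UA p). tauto. }
  rewrite (E z) by (intros Hi; apply Hl in Hi; tauto).
  rewrite (csum_perm _ _ _ Pl), csum_app.
  change (csum (principal_part o a z) l1) with (csum (fun q => P q z) l1).
  field. apply two_PI_Ci_nz.
Qed.

(** * The two expressions for the error *)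

Lemma regions_increasing (Omega : nat -> C -> Prop) m M p :
  (forall m p, Omega m p -> Omega (S m) p) -> (m <= M)%nat -> Omega m p -> Omega M p.
Proof. intros H. induction 1; auto. Qed.

Theorem proposition2 (f : C -> C) (o : C -> nat) (a : C -> Z -> C)
    (Omega : nat -> C -> Prop) (gamma : nat -> R -> C) (g : C -> C)
    (Hf : meromorphic f)
    (Hpoles : forall p : C, is_pole f p -> pole_data f p (o p) (a p))
    (Hregions : exhausting_regions f Omega gamma)
    (Hexpansion : full_expansion f o a Omega gamma g) :
  forall (m : nat) (z : C), Omega m z -> ~ is_pole f z ->
    (exists s : C,
       region_sum Omega (fun p => is_pole f p /\ ~ Omega m p)
         (principal_part o a z) s /\
       approx_expansion f o a Omega g m z - f z = - s) /\
    approx_expansion f o a Omega g m z - f z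
      = g z - cauchy_integral (gamma m) f z.
Proof.
  intros m z Hz Nz. destruct Hregions as [Hreg [Hinc [_ Hno]]]. unfold approx_expansion.
  split.
  - destruct (Hexpansion z Nz) as [_ [s [Hs Efz]]].
    set (Sm := sum_over (fun p => is_pole f p /\ Omega m p) (principal_part o a z)).
    (* The sum over the outer poles is the full sum less the finite part in [Omega m]. *)
    exists (s - Sm). split; [|rewrite Efz; ring].
    unfold region_sum, C_cvg in *. rewrite filterlim_C_iff in * by apply eventually_filter.
    (* From index m on, [Omega m] lies in [Omega M], so the partial sum over [Omega M] splits into
       the constant [Sm] and the partial sum over the outer poles. *)
    intros eps He. destruct (Hs eps He) as [K HK]. exists (max K m). intros M HM.
    specialize (HK M ltac:(lia)).
    destruct (finitely_many_poles f (Omega M) Hf (proj1 (Hreg M))) as [l Hl].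
    rewrite (sum_over_split l _ (Omega m) _ Hl) in HK.
    destruct (enumerates_sublist l (Omega m)) as [l1 H1].
    destruct (enumerates_sublist l (fun p => ~ Omega m p)) as [l2 H2].
    assert (Inc : forall p, Omega m p -> Omega M p)
      by (intros p; apply regions_increasing; auto; lia).
    rewrite (sum_over_ext l1 (fun p => (is_pole f p /\ Omega M p) /\ Omega m p)
      (fun p => is_pole f p /\ Omega m p)) in HK.
    2:{ intros p. specialize (Inc p). tauto. }
    2:{ apply enumerates_ext with (2 := H1). intros p. rewrite (proj2 Hl p). tauto. }
    rewrite (sum_over_ext l2 (fun p => (is_pole f p /\ Omega M p) /\ ~ Omega m p)
      (fun p => (is_pole f p /\ ~ Omega m p) /\ Omega M p)) in HK.
    2:{ intros p. tauto. }
    2:{ apply enumerates_ext with (2 := H2). intros p. rewrite (proj2 Hl p). tauto. }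
    fold Sm in HK. eapply Rle_lt_trans. 2: exact HK. right. f_equal. ring.
  - rewrite (cauchy_integral_meromorphic f o a (Omega m) (gamma m) z); auto. ring.
    intros p. apply Hno.
Qed.
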